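(* Let $f:\mathbb{R}^n\to\mathbb{R}\cup\{+\infty\}$ be proper, convex and lower semicontinuous, and let $g:\mathbb{R}^n\to\mathbb{R}$ be a (possibly nonconvex) Fréchet differentiable function whose gradient is $\beta$-Lipschitz continuous for some $\beta\ge 0$. Suppose that $f+g$ is bounded from below and that $\eta>0$ satisfies $\eta\beta(3+\eta\beta)<1$. For $x_0\in\mathbb{R}^n$, let $x\in C^1([0,+\infty),\mathbb{R}^n)$ be the unique global solution of $$\dot x(t)+x(t)=\operatorname{prox}_{\eta f}\big(x(t)-\eta\nabla g(x(t))\big),\qquad x(0)=x_0,$$ and consider the function $$H:\mathbb{R}^n\times\mathbb{R}^n\to\mathbb{R}\cup\{+\infty\},\qquad H(u,v)=(f+g)(u)+\frac{1}{2\eta}\|u-v\|^2.$$ Suppose that $x$ is bounded and that $H$ is a KL function. Then: (a) $\dot x\in L^1([0,+\infty);\mathbb{R}^n)$; (b) there exists $\overline x\in\operatorname{crit}(f+g)$ such that $\lim_{t\to+\infty}x(t)=\overline x$.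
   Context: $\mathbb{R}^n$ carries the Euclidean inner product and norm. The proximal point operator is $\operatorname{prox}_{\eta f}(y)=\operatorname{argmin}_{u\in\mathbb{R}^n}\{f(u)+\frac{1}{2\eta}\|u-y\|^2\}$; it is nonexpansive, and the dynamical system has a unique global $C^1$ solution by the Cauchy–Lipschitz theorem. For a proper lower semicontinuous $h:\mathbb{R}^m\to\mathbb{R}\cup\{+\infty\}$ with $\operatorname{dom}h=\{x:h(x)<+\infty\}$, the Fréchet subdifferential at $x\in\operatorname{dom}h$ is $\hat\partial h(x)=\{v:\liminf_{y\to x}\frac{h(y)-h(x)-\langle v,y-x\rangle}{\|y-x\|}\ge 0\}$, and the limiting (Mordukhovich) subdifferential is $\partial h(x)=\{v:\exists x_k\to x,\ h(x_k)\to h(x),\ \exists v_k\in\hat\partial h(x_k),\ v_k\to v\}$; both are empty for $x\notin\operatorname{dom}h$. $\operatorname{crit}(h)=\{x:0\in\partial h(x)\}$, $\operatorname{dom}\partial h=\{x:\partial h(x)\ne\emptyset\}$, and $\operatorname{dist}(x,A)=\inf_{y\in A}\|x-y\|$. For $\mu\in(0,+\infty]$, $\Theta_\mu$ is the class of concave continuous functions $\varphi:[0,\mu)\to[0,+\infty)$ with $\varphi(0)=0$, $\varphi$ continuously differentiable on $(0,\mu)$ and $\varphi'(s)>0$ for all $s\in(0,\mu)$. A proper lower semicontinuous $h$ satisfies the Kurdyka–Łojasiewicz (KL) property at $\overline x\in\operatorname{dom}\partial h$ if there exist $\mu\in(0,+\infty]$, a neighborhood $U$ of $\overline x$ and $\varphi\in\Theta_\mu$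 such that $\varphi'(h(x)-h(\overline x))\operatorname{dist}(0,\partial h(x))\ge 1$ for all $x\in U$ with $h(\overline x)<h(x)<h(\overline x)+\mu$. $h$ is a KL function if it satisfies the KL property at every point of $\operatorname{dom}\partial h$. *)

(* Defs.v *)
From HB Require Import structures.
From mathcomp Require Import all_boot all_order all_algebra.
From mathcomp Require Import all_classical all_reals all_analysis.

Set Implicit Arguments.
Unset Strict Implicit.
Unset Printing Implicit Defensive.

Import Order.TTheory GRing.Theory Num.Theory.
Import numFieldNormedType.Exports.

Local Open Scope classical_set_scope.
Local Open Scope ring_scope.

(* MathComp-Analysis puts the sup norm on ['rV[R]_n]; only its topology and its
   (norm-independent) notion of Fréchet differentiability are used below. All
   metric quantities go through the Euclidean [dotv] and [enorm]. *)
Definition dotv {R : realType} {n : nat} (u v : 'rV[R]_n) : R :=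
  \sum_(i < n) u 0 i * v 0 i.

Definition enorm {R : realType} {n : nat} (u : 'rV[R]_n) : R :=
  Num.sqrt (dotv u u).

Definition grad {R : realType} {n : nat} (g : 'rV[R]_n -> R) (x : 'rV[R]_n) :
    'rV[R]_n :=
  \row_(i < n) 'd g x (delta_mx 0 i : 'rV[R]_n).

Section ExtendedRealFunctions.
Context {R : realType} {n : nat}.
Implicit Types (h f : 'rV[R]_n -> \bar R) (g : 'rV[R]_n -> R).
Local Open Scope ereal_scope.

Definition domf h : set 'rV[R]_n := [set x | h x < +oo].

Definition proper_fun h : Prop :=
  (forall x, h x != -oo) /\ exists x, domf h x.

(* Only used for functions avoiding -oo, so that no sum below is +oo - oo. *)
Definition econvex h : Prop :=
  forall (x y : 'rV[R]_n) (l : R), (0 < l < 1)%R ->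
    h (l *: x + (1 - l) *: y)%R <= l%:E * h x + (1 - l)%:E * h y.

Definition argmin h : set 'rV[R]_n := [set u | forall v, h u <= h v].

(* For f proper, convex, lsc and eta > 0 the argmin is a singleton, so the
   default value 0 of [xget] is never taken. *)
Definition prox (eta : R) f (y : 'rV[R]_n) : 'rV[R]_n :=
  xget 0%R
    (argmin (fun u => f u + ((2 * eta)^-1 * enorm (u - y) ^+ 2)%R%:E)).

Definition fg_sum f g : 'rV[R]_n -> \bar R := fun u => f u + (g u)%:E.

(* The liminf is over y -> x with y <> x. *)
Definition frechet_subdiff h (x : 'rV[R]_n) : set 'rV[R]_n :=
  [set v | domf h x /\
    0 <= limf_einf
      (fun y => (h y - h x - (dotv v (y - x))%:E) * ((enorm (y - x))^-1)%:E)
      (x^' : set (set 'rV[R]_n))].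

Definition limiting_subdiff h (x : 'rV[R]_n) : set 'rV[R]_n :=
  [set v | domf h x /\
    exists (xs vs : nat -> 'rV[R]_n),
      [/\ xs k @[k --> \oo] --> x,
          h (xs k) @[k --> \oo] --> h x,
          forall k, frechet_subdiff h (xs k) (vs k) &
          vs k @[k --> \oo] --> v]].

Definition crit h : set 'rV[R]_n := [set x | limiting_subdiff h x 0%R].

Definition dom_subdiff h : set 'rV[R]_n :=
  [set x | limiting_subdiff h x !=set0].

(* Equal to +oo when A is empty. *)
Definition distE (x : 'rV[R]_n) (A : set 'rV[R]_n) : \bar R :=
  ereal_inf [set (enorm (x - y))%:E | y in A].

End ExtendedRealFunctions.

(* [phi] is total on R, but only its values on [0, mu) are constrained. *)
Definition Theta {R : realType} (mu : \bar R) (phi : R -> R) : Prop :=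
  let D := [set s : R | 0 <= s /\ (s%:E < mu)%E] in
  let D0 := [set s : R | 0 < s /\ (s%:E < mu)%E] in
  [/\ forall s, D s -> 0 <= phi s,
      forall s t l, D s -> D t -> 0 <= l <= 1 ->
        l * phi s + (1 - l) * phi t <= phi (l * s + (1 - l) * t),
      {within D, continuous phi},
      phi 0 = 0 &
      [/\ forall s, D0 s -> derivable phi s 1,
          {within D0, continuous (derive1 phi)} &
          forall s, D0 s -> 0 < derive1 phi s]].

Definition KL_at {R : realType} {m : nat} (h : 'rV[R]_m -> \bar R)
    (xb : 'rV[R]_m) : Prop :=
  exists (mu : \bar R) (U : set 'rV[R]_m) (phi : R -> R),
    [/\ (0 < mu)%E, nbhs xb U, Theta mu phi &
        forall x, U x -> (h xb < h x)%E -> (h x < h xb + mu)%E ->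
          (1 <= (derive1 phi (fine (h x - h xb)))%:E
                * distE 0 (limiting_subdiff h x))%E].

Definition KL_function {R : realType} {m : nat} (h : 'rV[R]_m -> \bar R) :
    Prop :=
  forall xb, dom_subdiff h xb -> KL_at h xb.

Definition regH {R : realType} {n : nat} (f : 'rV[R]_n -> \bar R)
    (g : 'rV[R]_n -> R) (eta : R) (u v : 'rV[R]_n) : \bar R :=
  (fg_sum f g u + ((2 * eta)^-1 * enorm (u - v) ^+ 2)%:E)%E.

(* R^n x R^n, with the product Euclidean structure, is R^(n + n). *)
Definition on_concat {R : realType} {n : nat}
    (F : 'rV[R]_n -> 'rV[R]_n -> \bar R) : 'rV[R]_(n + n) -> \bar R :=
  fun w => F (lsubmx w) (rsubmx w).

(* Difference quotients at t >= 0 are restricted to s in [0, +oo), so the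
   derivative is two-sided for t > 0 and right-sided at t = 0, and it does not
   depend on the values of [x] at negative times. *)
Definition hl_quotient {R : realType} {n : nat} (x : R -> 'rV[R]_n) (t : R) :
    set_system 'rV[R]_n :=
  (s - t)^-1 *: (x s - x t) @[s --> within `[0, +oo[ t^'].

Definition hl_deriv {R : realType} {n : nat} (x : R -> 'rV[R]_n) (t : R) :
    'rV[R]_n :=
  lim (hl_quotient x t).

Definition hl_C1 {R : realType} {n : nat} (x : R -> 'rV[R]_n) : Prop :=
  (forall t, 0 <= t -> cvg (hl_quotient x t)) /\
  {within `[0, +oo[, continuous (hl_deriv x)}.

Definition fb_solution {R : realType} {n : nat} (f : 'rV[R]_n -> \bar R)
    (g : 'rV[R]_n -> R) (eta : R) (x0 : 'rV[R]_n) (x : R -> 'rV[R]_n) : Prop :=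
  [/\ hl_C1 x,
      forall t, 0 <= t ->
        hl_deriv x t + x t = prox eta f (x t - eta *: grad g (x t)) &
      x 0 = x0].

Definition L1_on {R : realType} {n : nat} (D : set R) (y : R -> 'rV[R]_n) :
    Prop :=
  (forall i : 'I_n, measurable_fun D (fun t => y t 0 i)) /\
  (\int[lebesgue_measure]_(t in D) (enorm (y t))%:E < +oo)%E.

(* Main.v *)
Require Import Defs.
From HB Require Import structures.
From mathcomp Require Import all_boot all_order all_algebra.
From mathcomp Require Import all_classical all_reals all_analysis.
From mathcomp Require Import ring lra.

Import Order.TTheory GRing.Theory Num.Theory.
Import numFieldNormedType.Exports.
Local Open Scope classical_set_scope.
Local Open Scope ring_scope.

(* Put [u(t) = x(t) + x'(t)], the forward-backward point of [x(t)]. Since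
   [(x - u)/eta - grad g x] is a subgradient of [f] at [u], comparing
   [E(t) = H(u(t), x(t))] at two times gives the right Dini inequality
   [E' <= - c |x'|^2] with [c = 1/eta - beta (1 + eta beta) > 0]; no almost
   everywhere differentiability of [u] is required. So [E] decreases to a limit
   [l], [x' -> 0], and at a cluster point [xb] of [x] the closedness of the
   subdifferential of [f] gives [H(xb, xb) = l] and [0] in the subdifferential
   of [f + g]. As [H] has a subgradient of norm at most [(beta + 1/eta) |x'|] at
   [(u, x)], the KL inequality at [(xb, xb)] turns the decrease of [E] into
   [(k phi(E - l))' <= - |x'|] as long as [x] stays near [xb]. Hence, starting
   close enough to [xb], [x] remains trapped there and has finite length. *)

(** * Euclidean geometry of row vectors *)

(** The obstacle is regularity: [f] may be infinite along [x], and [u] is merely Lipschitz in time.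
    Hence [f] is evaluated only at [u], and everything about [E] comes from an inequality between
    two points: convexity is used with the subgradient at the later one, and all errors are
    quadratic in the displacement of [x] except for two first-order terms. The coupling term yields
    [-1/eta], through its second argument; the gradient of [g] being frozen at [x] instead of [u]
    yields [beta (1 + eta beta)], the Lipschitz constant of the gradient times that of the
    forward-backward map. This is the origin of [c]. The hypothesis on [eta] enters twice: as
    [eta beta (1 + eta beta) < 1] for [c > 0], and as [2 eta beta < 1] for the existence of proximal
    points. Calculus is replaced by one monotonicity principle: left lower semicontinuity and a
    nonpositive right Dini derivative prevent growth. The running integral of [|x'|] is then just
    one more function to add to [k phi(E - l)]. *)

Lemma subrACA {V : zmodType} (a b c d : V) : a - b - (c - d) = a - c - (b - d).
Proof. by rewrite !opprB !addrA addrAC [RHS]addrAC -!addrA; congr (_ + _); rewrite addrCA. Qed.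

Lemma subrDBK {V : zmodType} (a b c : V) : a - b + c - a = c - b.
Proof. by rewrite -[a - b + c]addrA [a + _]addrC addrK addrC. Qed.

Lemma normr_max0B {R : realType} (s t : R) :
  `|Num.max 0 t - Num.max 0 s| <= `|t - s|.
Proof.
have := ler_norm (t - s); have := ler_norm (s - t); rewrite (distrC s) ler_norml.
have := normr_ge0 (t - s).
by have [?|?] := leP 0 t; have [?|?] := leP 0 s => *; apply/andP; split; lra.
Qed.

Section Euclidean.
Context {R : realType} {n : nat}.
Implicit Types (u v w : 'rV[R]_n) (a : R).

Lemma dotvC u v : dotv u v = dotv v u.
Proof. by apply: eq_bigr => i _; rewrite mulrC. Qed.

Lemma dotvDl u v w : dotv (u + v) w = dotv u w + dotv v w.
Proof. by rewrite -big_split; apply: eq_bigr => i _; rewrite mxE mulrDl. Qed.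

Lemma dotvZl a u v : dotv (a *: u) v = a * dotv u v.
Proof. by rewrite mulr_sumr; apply: eq_bigr => i _; rewrite mxE mulrA. Qed.

Lemma dotvNl u v : dotv (- u) v = - dotv u v.
Proof. by rewrite -scaleN1r dotvZl mulN1r. Qed.

Lemma dotvDr u v w : dotv w (u + v) = dotv w u + dotv w v.
Proof. by rewrite !(dotvC w) dotvDl. Qed.

Lemma dotvZr a u v : dotv u (a *: v) = a * dotv u v.
Proof. by rewrite !(dotvC u) dotvZl. Qed.

Lemma dotvNr u v : dotv u (- v) = - dotv u v.
Proof. by rewrite !(dotvC u) dotvNl. Qed.

Lemma dotv0l u : dotv 0 u = 0.
Proof. by rewrite -(scale0r 0) dotvZl mul0r. Qed.

Definition dotvE := (dotvDl, dotvDr, dotvNl, dotvNr, dotvZl, dotvZr).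

Lemma dotv_ge0 u : 0 <= dotv u u.
Proof. by apply: sumr_ge0 => i _; rewrite -expr2 sqr_ge0. Qed.

Lemma enorm_ge0 u : 0 <= enorm u.
Proof. exact: sqrtr_ge0. Qed.

Lemma sqr_enorm u : enorm u ^+ 2 = dotv u u.
Proof. by rewrite sqr_sqrtr ?dotv_ge0. Qed.

Lemma enorm0 : enorm (0 : 'rV[R]_n) = 0.
Proof. by rewrite /enorm dotv0l sqrtr0. Qed.

Lemma enormZ a u : enorm (a *: u) = `|a| * enorm u.
Proof.
by rewrite /enorm dotvZl dotvZr mulrA -expr2 sqrtrM ?sqr_ge0// sqrtr_sqr.
Qed.

Lemma enormN u : enorm (- u) = enorm u.
Proof. by rewrite -scaleN1r enormZ normrN1 mul1r. Qed.

Lemma enormB u v : enorm (u - v) = enorm (v - u).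
Proof. by rewrite -opprB enormN. Qed.

Lemma coord_le_enorm u i : `|u 0 i| <= enorm u.
Proof.
rewrite -sqrtr_sqr; apply: ler_wsqrtr; rewrite /dotv (bigD1 i)//= expr2.
by rewrite lerDl sumr_ge0// => j _; rewrite -expr2 sqr_ge0.
Qed.

Lemma enorm0_eq0 u : enorm u = 0 -> u = 0.
Proof.
move=> u0; apply/rowP => i; rewrite mxE; apply/eqP; rewrite -normr_eq0.
by rewrite eq_le normr_ge0 andbT -u0 coord_le_enorm.
Qed.

Lemma cauchy_schwarz u v : `|dotv u v| <= enorm u * enorm v.
Proof.
have [v0|v0] := eqVneq (dotv v v) 0.
  have -> : v = 0 by apply: enorm0_eq0; rewrite /enorm v0 sqrtr0.
  by rewrite dotvC dotv0l normr0 mulr_ge0// enorm_ge0.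
have vgt0 : 0 < dotv v v by rewrite lt0r v0 dotv_ge0.
rewrite -(ler_pXn2r (ltn0Sn 1)) ?nnegrE ?mulr_ge0 ?enorm_ge0//.
rewrite exprMn !sqr_enorm real_normK ?num_real//.
have := dotv_ge0 (dotv v v *: u - dotv u v *: v).
rewrite !dotvE (dotvC v u) -(ler_pM2l vgt0) => h; lra.
Qed.

Lemma dotv_le u v : dotv u v <= enorm u * enorm v.
Proof. exact: le_trans (ler_norm _) (cauchy_schwarz u v). Qed.

Lemma enormD u v : enorm (u + v) <= enorm u + enorm v.
Proof.
rewrite -(ler_pXn2r (ltn0Sn 1)) ?nnegrE ?addr_ge0 ?enorm_ge0//.
rewrite sqrrD !sqr_enorm !dotvE (dotvC v u); have := dotv_le u v; lra.
Qed.

Lemma enorm_triangle w u v : enorm (u - v) <= enorm (u - w) + enorm (w - v).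
Proof. by rewrite (_ : u - v = (u - w) + (w - v)) ?enormD// subrKA. Qed.

Lemma enorm_le_mx_norm u : enorm u <= n%:R * `|u|.
Proof.
have uE : u = \sum_(i < n) u 0 i *: 'e_i by rewrite [LHS]matrix_sum_delta big_ord1.
rewrite {1}uE.
apply: (@le_trans _ _ (\sum_(i < n) `|u|)); last first.
  by rewrite sumr_const card_ord mulr_natl.
elim/big_ind2 : _ => [|a b c d ab cd|i _]; first by rewrite enorm0.
  exact: le_trans (enormD _ _) (lerD ab cd).
rewrite enormZ (_ : enorm 'e_i = 1) ?mulr1; last first.
  rewrite /enorm /dotv (bigD1 i)//= big1 ?addr0 ?mxE ?eqxx ?mulr1 ?sqrtr1//.
  by move=> j ji; rewrite mxE eqxx (negbTE ji) mulr0.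
by apply: le_trans (le_bigmax _ (fun ij => `|u ij.1 ij.2|) (0, i)) _; rewrite {2}/Num.norm/= mx_normrE.
Qed.

Lemma mx_norm_le_enorm u : `|u| <= enorm u.
Proof.
rewrite {1}/Num.norm/= mx_normrE; apply/bigmax_leP; split => [|[i j] _]/=.
  exact: enorm_ge0.
by rewrite (ord1 i) coord_le_enorm.
Qed.

(** Bridge between the library topology, built on the sup norm, and Euclidean balls: each norm is
    bounded by a multiple of the other. *)
Lemma nbhs_enormP u (A : set 'rV[R]_n) :
  nbhs u A <-> exists2 e, 0 < e & forall v, enorm (v - u) < e -> A v.
Proof.
split=> [/nbhs_normP[e /= e0 uA]|[e e0 uA]]; [exists e => //|] => [v ve|].
  by apply: uA; rewrite /ball_/= distrC; exact: le_lt_trans (mx_norm_le_enorm _) ve.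
(* Taking [n.+1] rather than [n] avoids a division by zero in dimension 0. *)
apply/(@nbhs_normP _ _ u A); exists (e / n.+1%:R) => /=; first by rewrite divr_gt0.
move=> v; rewrite /ball_/= ltr_pdivlMr// => ve; apply: uA.
rewrite enormB; apply: le_lt_trans ve; apply: le_trans (enorm_le_mx_norm _) _.
by rewrite mulrC ler_wpM2l// ler_nat.
Qed.

Lemma cvg_enormP {T : Type} (F : set_system T) {FF : Filter F}
    (h : T -> 'rV[R]_n) u :
  h t @[t --> F] --> u <->
  forall e, 0 < e -> \forall t \near F, enorm (h t - u) < e.
Proof.
split=> [hu e e0|hu A /nbhs_enormP[e e0 eA]].
  by apply: (hu [set v | enorm (v - u) < e]); apply/nbhs_enormP; exists e.
by apply: filterS (hu e e0) => t; exact: eA.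
Qed.

Lemma enorm_dist u v : `|enorm u - enorm v| <= enorm (u - v).
Proof.
have := enormD (u - v) v; have := enormD (v - u) u.
rewrite !subrK (enormB v u) ler_norml; lra.
Qed.

Lemma continuous_enorm : continuous (@enorm R n).
Proof.
move=> u A /nbhs_ballP[e /= e0 eA]; apply/nbhs_enormP; exists e => // v ve.
by apply: eA; rewrite /ball/= distrC (le_lt_trans (enorm_dist _ _)).
Qed.

End Euclidean.

Lemma compact_enorm_ball {R : realType} {n : nat} (M : R) :
  compact [set u : 'rV[R]_n | enorm u <= M].
Proof.
apply: bounded_closed_compact.
  exists M; split; first exact: num_real.
  by move=> N MN u uM; apply: le_trans (mx_norm_le_enorm _) (le_trans uM (ltW MN)).
rewrite (_ : [set u | _] = (@enorm R n) @^-1` [set r | r <= M])//.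
by apply: closed_comp; [move=> u _; exact: continuous_enorm|exact: closed_le].
Qed.

Lemma enorm_row_mx {R : realType} {n m : nat} (u : 'rV[R]_n) (v : 'rV[R]_m) :
  enorm (row_mx u v) ^+ 2 = enorm u ^+ 2 + enorm v ^+ 2.
Proof.
rewrite !sqr_enorm /dotv big_split_ord/=.
by congr (_ + _); apply: eq_bigr => i _; rewrite ?row_mxEl ?row_mxEr.
Qed.

Lemma dotv_row_mx {R : realType} {n m : nat} (u u' : 'rV[R]_n)
    (v v' : 'rV[R]_m) :
  dotv (row_mx u v) (row_mx u' v') = dotv u u' + dotv v v'.
Proof.
rewrite /dotv big_split_ord/=.
by congr (_ + _); apply: eq_bigr => i _; rewrite ?row_mxEl ?row_mxEr.
Qed.

Lemma continuous_quadratic_bound {R : realType} {n : nat} (q : 'rV[R]_n -> R) :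
  (forall u, exists A B : R, 0 <= A /\ 0 <= B /\
    forall v, `|q v - q u| <= A * enorm (v - u) + B * enorm (v - u) ^+ 2) ->
  continuous q.
Proof.
move=> hq u S /nbhs_ballP[e /= e0 eS]; have [A [B [A0 [B0 hAB]]]] := hq u.
have AB : 0 < A + B + 1 by rewrite ltr_wpDl// addr_ge0.
apply/nbhs_enormP; exists (Num.min 1 (e / (A + B + 1))).
  by rewrite lt_min ltr01/= divr_gt0.
move=> v; rewrite lt_min ltr_pdivlMr// => /andP[d1 d2].
apply: eS; rewrite /ball/= distrC; apply: le_lt_trans (hAB v) _.
apply: le_lt_trans d2; have := enorm_ge0 (v - u); set d := enorm _ in d1 * => d0.
have : d ^+ 2 <= d by rewrite expr2 ler_piMl// ltW.
by move=> /(ler_wpM2l B0); lra.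
Qed.

(** * Monotonicity from one-sided Dini derivatives *)

Section Dini.
Context {R : realType}.
Implicit Types (h : R -> R) (a b s t m : R).

(** Carries an upper bound valid on [[a, s[] over to [s]; times before [a] are excluded because
    trajectories are controlled only on a half-line. *)
Definition left_lsc a h s := forall e, 0 < e ->
  exists2 d, 0 < d & forall t, a <= t < s -> s - t < d -> h s <= h t + e.

(** The upper right Dini derivative of [h] at [s] is at most [m], with the quotient cleared so that
    such bounds add up without limits superior. *)
Definition right_dini_le h s m := forall e, 0 < e ->
  exists2 d, 0 < d & forall t, s < t -> t - s < d -> h t <= h s + (m + e) * (t - s).

Lemma left_lscD a h1 h2 s :
  left_lsc a h1 s -> left_lsc a h2 s -> left_lsc a (h1 \+ h2) s.
Proof.
move=> l1 l2 e e0; have e20 : 0 < e / 2 by rewrite divr_gt0.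
have [d1 d10 hd1] := l1 _ e20; have [d2 d20 hd2] := l2 _ e20.
exists (Num.min d1 d2); first by rewrite lt_min d10.
move=> t ts; rewrite lt_min => /andP[/(hd1 t ts) + /(hd2 t ts)] /=; lra.
Qed.

Lemma right_dini_leD h1 h2 s m1 m2 : right_dini_le h1 s m1 ->
  right_dini_le h2 s m2 -> right_dini_le (h1 \+ h2) s (m1 + m2).
Proof.
move=> l1 l2 e e0; have e20 : 0 < e / 2 by rewrite divr_gt0.
have [d1 d10 hd1] := l1 _ e20; have [d2 d20 hd2] := l2 _ e20.
exists (Num.min d1 d2); first by rewrite lt_min d10.
move=> t ts; rewrite lt_min => /andP[/(hd1 t ts) + /(hd2 t ts)] /=; lra.
Qed.

Lemma right_dini_le_weaken h s m1 m2 : m1 <= m2 -> right_dini_le h s m1 ->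
  right_dini_le h s m2.
Proof.
move=> m12 l e e0; have [d d0 hd] := l _ e0; exists d => // t st tsd.
by apply: le_trans (hd t st tsd) _; rewrite lerD2l ler_pM2r ?subr_gt0// lerD2r.
Qed.

Lemma linear_left_lsc a m s : left_lsc a (fun t => m * t) s.
Proof.
move=> e e0; have m0 : 0 < `|m| + 1 by rewrite ltr_wpDl.
exists (e / (`|m| + 1)); first by rewrite divr_gt0.
move=> t /andP[_ ts]; rewrite ltr_pdivlMr// => h.
have st : 0 <= s - t by rewrite subr_ge0 ltW.
have := ler_wpM2r st (ler_norm m); lra.
Qed.

Lemma linear_right_dini_le m s : right_dini_le (fun t => m * t) s m.
Proof.
move=> e e0; exists 1 => // t st _; have : 0 <= e * (t - s).
  by rewrite mulr_ge0 ?ltW ?subr_gt0.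
lra.
Qed.

(* The right-derivative hypothesis is needed only at points where [h] has not
   yet exceeded [h a + k]: this is what makes trapping arguments work. *)
Lemma right_dini_nonincreasing h a b k :
  a <= b -> 0 < k ->
  (forall s, a < s <= b -> left_lsc a h s) ->
  (forall s, a <= s < b -> h s <= h a + k -> right_dini_le h s 0) ->
  h b <= h a.
Proof.
move=> ab k0 hl hr; apply/ler_addgt0Pr => e0 e00.
have [|ba] := leP b a; first by move=> ba; rewrite (le_anti (introT andP (conj ab ba))) lerDl ltW.
(* With this slope the total growth over [[a, b]] is at most [e0], the error tolerated at the end,
   and at most [k], so that the conditional hypothesis [hr] stays applicable. *)
pose e := Num.min e0 k / (b - a).
have mgt0 : 0 < Num.min e0 k by rewrite lt_min e00.
have bagt0 : 0 < b - a by rewrite subr_gt0.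
have egt0 : 0 < e by rewrite divr_gt0.
have eba : e * (b - a) = Num.min e0 k by rewrite mulfVK ?gt_eqF.
(* Continuous induction on the times up to which [h] stays below a line of slope [e]: left lower
   semicontinuity puts [sup S] into [S], and the Dini bound there would extend [S] further if it
   were less than [b]. *)
pose S := [set s | a <= s <= b /\ forall r, a <= r <= s -> h r <= h a + e * (r - a)].
have Sa : S a.
  split; first by rewrite lexx ab.
  by move=> r /andP[ar ra]; rewrite (le_anti (introT andP (conj ra ar))) subrr mulr0 addr0.
have Sb : has_sup S by split; [exists a|exists b => s [/andP[]]].
pose c := sup S.
have ac : a <= c by apply: ub_le_sup => //; case: Sb.
have cb : c <= b by apply: ge_sup; [exists a|move=> s [/andP[]]].
have below r : a <= r < c -> h r <= h a + e * (r - a).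
  move=> /andP[ar rc]; have [s [sab Ss] rs] := sup_adherent (eps := c - r) (ltac:(by rewrite subr_gt0)) Sb.
  by apply: Ss; rewrite ar/= ltW//; move: rs; rewrite -/c subKr.
have hc : h c <= h a + e * (c - a).
  have [ca|ca] := leP c a.
    by have -> : c = a by [apply: le_anti; rewrite ca]; rewrite subrr mulr0 addr0.
  apply/ler_addgt0Pr => e1 e10; have [|d d0 hd] := hl c _ e1 e10; first by rewrite ca.
  pose t := Num.max a (c - d / 2).
  have tc : t < c by rewrite gt_max ca ltrBlDr ltrDl divr_gt0.
  have at_ : a <= t by rewrite le_max lexx.
  have ctd : c - t < d.
    have : c - d / 2 <= t by rewrite le_max lexx orbT.
    lra.
  apply: le_trans (hd t _ ctd) _; first by rewrite at_.
  rewrite lerD2r; apply: le_trans (below t _) _; first by rewrite at_.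
  by rewrite lerD2l ler_pM2l// lerD2r ltW.
have Sc : S c.
  split; first by rewrite ac.
  move=> r /andP[ar]; rewrite le_eqVlt => /predU1P[->//|rc].
  by apply: below; rewrite ar.
have [bc|cltb] := leP b c.
  have cE : c = b by apply: le_anti; rewrite cb.
  move: hc; rewrite cE eba => /le_trans; apply.
  by rewrite lerD2l ge_min lexx.
have hck : h c <= h a + k.
  apply: le_trans hc _; rewrite lerD2l; apply: (@le_trans _ _ (e * (b - a))).
    by rewrite ler_pM2l// lerD2r.
  by rewrite eba ge_min lexx orbT.
have [|d d0 hd] := hr c _ hck e egt0; first by rewrite ac.
pose t := Num.min b (c + d / 2).
have ct : c < t by rewrite lt_min cltb ltrDl divr_gt0.
have tb : t <= b by rewrite ge_min lexx.
have td : t - c < d.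
  have : t <= c + d / 2 by rewrite ge_min lexx orbT.
  lra.
suff St : S t by have := ub_le_sup (proj2 Sb) St; rewrite leNgt -/c ct.
split; first by rewrite tb (le_trans ac)// ltW.
move=> r /andP[ar rt]; have [rc|cr] := leP r c; first by apply: (proj2 Sc); rewrite ar.
have rb : r <= b := le_trans rt tb.
have : h r <= h c + (0 + e) * (r - c) by apply: hd => //; lra.
move: hc; lra.
Qed.

End Dini.

(** * Subgradients and proximal points *)

Section Gradient.
Context {R : realType} {n : nat}.
Implicit Types (u v w : 'rV[R]_n).

Lemma diff_grad (g : 'rV[R]_n -> R) u w :
  differentiable g u -> 'd g u w = dotv (grad g u) w.
Proof.
move=> dg; have {1}-> : w = \sum_(i < n) w 0 i *: 'e_i.
  by rewrite [LHS]matrix_sum_delta big_ord1.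
rewrite linear_sum; apply: eq_bigr => i _.
by rewrite linearZ/= mxE mulrC.
Qed.

Lemma is_derive_line (g : 'rV[R]_n -> R) u w (t : R) :
  differentiable g (u + t *: w) ->
  is_derive t 1 (fun s : R => g (u + s *: w)) (dotv (grad g (u + t *: w)) w).
Proof.
move=> dg; have dv := @diff_derivable _ _ _ _ _ w dg.
have E : (fun h : R => h^-1 *: (((fun s : R => g (u + s *: w)) \o shift t) (h *: 1)
             - g (u + t *: w))) =
         (fun h : R => h^-1 *: ((g \o shift (u + t *: w)) (h *: w) - g (u + t *: w))).
  apply/funext => h; congr (_ *: (g _ - _)) => /=.
  by rewrite [h *: 1]mulr1 scalerDl addrCA.
apply: DeriveDef; first by rewrite /derivable E.
by rewrite /derive E -diff_grad// -deriveE.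
Qed.

(* The mean value theorem gives [beta] instead of the optimal [beta / 2]; this
   suffices because [eta * beta < 1 / 3]. *)
Lemma taylor_le (g : 'rV[R]_n -> R) (beta : R) u v :
  (forall u, differentiable g u) ->
  0 <= beta ->
  (forall u v, enorm (grad g u - grad g v) <= beta * enorm (u - v)) ->
  `|g v - g u - dotv (grad g u) (v - u)| <= beta * enorm (v - u) ^+ 2.
Proof.
move=> dg beta0 lip; pose w := v - u.
have [] := @MVT_segment R (fun s => g (u + s *: w))
  (fun s => dotv (grad g (u + s *: w)) w) 0 1 ler01.
- by move=> s _; apply: is_derive_line.
- apply: derivable_within_continuous => s _.
  by apply: ex_derive; apply: is_derive_line.
move=> s; rewrite in_itv/= => /andP[s0 s1].
rewrite scale1r scale0r addr0 subr0 mulr1 {1}/w [u + _]addrC subrK => ->.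
rewrite -dotvNl -dotvDl; apply: le_trans (cauchy_schwarz _ _) _.
rewrite expr2 mulrA ler_wpM2r ?enorm_ge0//; apply: le_trans (lip _ _) _.
rewrite [u + _]addrC addrK enormZ ger0_norm// ler_wpM2l//.
by rewrite ler_piMl// enorm_ge0.
Qed.

End Gradient.

Section Subgradient.
Context {R : realType} {n : nat}.
Implicit Types (h f : 'rV[R]_n -> \bar R) (u v w p q x : 'rV[R]_n).

(** Divided by [enorm (y - x)], a quadratic error tends to 0. The limiting subgradients of [f + g]
    and of [H] are both obtained this way, with [K = beta]. *)
Lemma frechet_subdiff_quadratic h x v (K : R) :
  h x \is a fin_num ->
  (forall y, ((fine (h x) + dotv v (y - x) - K * enorm (y - x) ^+ 2)%:E <= h y)%E) ->
  frechet_subdiff h x v.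
Proof.
move=> hx hy; split; first by rewrite /domf/= ltey_eq hx.
rewrite /limf_einf leeNr oppe0; apply/lee_addgt0Pr => e e0; rewrite add0e.
(* On this punctured ball [K * enorm (y - x)] stays below [e]; the [+ 1] covers [K = 0]. *)
pose V := [set y | enorm (y - x) < e / (`|K| + 1) /\ y != x].
apply: (@le_trans _ _ (ereal_sup [set (- ((h y - h x - (dotv v (y - x))%:E)
    * ((enorm (y - x))^-1)%:E))%E | y in V])).
  apply: ereal_inf_lbound; exists V => //.
  rewrite /V /dnbhs/=; apply/nbhs_enormP; exists (e / (`|K| + 1)).
    by rewrite divr_gt0// ltr_wpDl.
  by move=> y yx yneq; split.
apply: ge_ereal_sup => _ [y [yx yneq] <-].
have d0 : 0 < enorm (y - x).
  rewrite lt0r enorm_ge0 andbT; apply: contra_neq yneq => /enorm0_eq0.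
  by move/eqP; rewrite subr_eq0 => /eqP.
have dV0 : 0 < (enorm (y - x))^-1 by rewrite invr_gt0.
move: yx; rewrite ltr_pdivlMr ?ltr_wpDl// => yx.
rewrite -(fineK hx); move: (hy y); case: (h y) => [r| |]//=.
- rewrite lee_fin => hr; rewrite lee_fin.
  rewrite -mulNr ler_pdivrMr//.
  apply: (@le_trans _ _ (`|K| * enorm (y - x) ^+ 2)).
    have : K * enorm (y - x) ^+ 2 <= `|K| * enorm (y - x) ^+ 2.
      by rewrite ler_wpM2r ?sqr_ge0 ?ler_norm.
    lra.
  rewrite expr2 mulrA ler_pM2r// mulrC; apply: ltW; apply: le_lt_trans yx.
  by rewrite ler_pM2l// lerDl.
- by move=> _; rewrite !addye// gt0_mulye//= leNye.
Qed.

Lemma frechet_limiting h x v : frechet_subdiff h x v -> limiting_subdiff h x v.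
Proof.
move=> hv; split; first by case: hv.
by exists (fun=> x), (fun=> v); split=> //; exact: cvg_cst.
Qed.

(** Along the flow, subgradients are handled as global affine minorants, which are monotone and pass
    to limits; they become elements of [limiting_subdiff] in [subgrad_fg_sum] and [subgrad_regH]. *)
Definition convex_subgrad f u p :=
  f u \is a fin_num /\
  forall v, ((fine (f u) + dotv p (v - u))%:E <= f v)%E.

Lemma convex_subgrad_monotone f u v p q :
  convex_subgrad f u p -> convex_subgrad f v q ->
  0 <= dotv (p - q) (u - v).
Proof.
move=> [fu /(_ v)] + [fv /(_ u)]; rewrite -{1}(fineK fv) -{2}(fineK fu) !lee_fin.
by rewrite -(opprB u v) !dotvE; lra.
Qed.

Lemma lsc_addl f (q : 'rV[R]_n -> R) :
  (forall u, f u != -oo%E) -> lower_semicontinuous f -> continuous q ->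
  lower_semicontinuous (fun u => (f u + (q u)%:E)%E).
Proof.
move=> fny flsc qc u a au.
have [b ab bu] : exists2 b, a - b < q u & (b%:E < f u)%E.
  move: au (fny u); case: (f u) => [r| |]//.
    rewrite -EFinD lte_fin => ar _; exists ((a - q u + r) / 2); last rewrite lte_fin; lra.
  by move=> _ _; exists (a - q u + 1); rewrite ?ltry//; lra.
have [V Vu fV] := flsc _ _ bu.
have qu : nbhs u [set v | a - b < q v].
  have /cvgrPdist_lt := qc u => /(_ (q u - (a - b))).
  rewrite subr_gt0 => /(_ ab); apply: filterS => v.
  by rewrite /= ltr_norml => /andP[_]; lra.
exists (V `&` [set v | a - b < q v]); first exact: filterI.
move=> v [/fV bv qv]; have : (b%:E + (a - b)%:E < f v + (q v)%:E)%E by apply: lteD.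
by rewrite -EFinD addrC subrK.
Qed.

(** No minimizing sequence is chosen. Sublevel sets are nested, so they generate a proper filter,
    which meets a compact ball. If some [v] had a smaller value than a cluster point [u], lower
    semicontinuity would keep [h] above [h v] near [u], where the sublevel set of [v]
    accumulates. *)
Lemma lsc_argmin h v0 (B : R) :
  (forall u, h u != -oo%E) -> lower_semicontinuous h ->
  (h v0 < +oo)%E ->
  (forall u, (h u <= h v0)%E -> enorm u <= B) ->
  exists u, argmin h u.
Proof.
move=> hny hlsc v0y hB; apply: contrapT => /forallNP nomin.
have better u : exists v, (h v < h u)%E.
  apply: contrapT => /forallNP hu; apply: (nomin u) => v.
  by rewrite leNgt; apply/negP.
pose F := filter_from setT (fun v => [set w | (h w <= h v)%E]).
have FF : ProperFilter F.
  apply: filter_from_proper; last by move=> v _; exists v => /=.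
  apply: filter_from_filter; first by exists v0.
  move=> v w _ _; have [vw|wv] := leP (h v) (h w).
    by exists v => // z /= zv; split => //; exact: le_trans vw.
  by exists w => // z /= zw; split => //; apply: le_trans zw (ltW wv).
have FB : F [set u | enorm u <= B] by exists v0 => // w /= /hB.
have [u [_ uF]] := compact_enorm_ball B _ FF FB.
have [v vu] := better u.
have [a vE] : exists a, h v = a%:E.
  exists (fine (h v)); rewrite fineK// fin_numE hny lt_eqF//.
  exact: lt_le_trans vu (leey _).
have [V Vu hV] : exists2 V, nbhs u V & forall y, V y -> (a%:E < h y)%E.
  by apply: hlsc; rewrite -vE.
have [w [/= wv /hV]] := uF [set w | (h w <= h v)%E] V (ltac:(by exists v)) Vu.
by rewrite -vE ltNge wv.
Qed.

(** First-order optimality: [u] is compared with [l *: v + (1 - l) *: u]. After convexity a factor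
    [l] divides out, and the remaining error [l * enorm (v - u) ^+ 2 / (2 * eta)] is made
    arbitrarily small. *)
Lemma argmin_prox_subgrad f (eta : R) y u :
  proper_fun f -> econvex f -> 0 < eta ->
  argmin (fun v => (f v + ((2 * eta)^-1 * enorm (v - y) ^+ 2)%:E)%E) u ->
  convex_subgrad f u (eta^-1 *: (y - u)).
Proof.
move=> [fny [x0 x0f]] fconv eta0 minu.
have fu : f u \is a fin_num.
  move: (minu x0) (fny u) x0f (fny x0); rewrite /domf/=.
  by case: (f u) => //; case: (f x0).
split=> // v.
move: (fny v); case fvE : (f v) => [a| |]// _; last by rewrite leey.
rewrite lee_fin; apply/ler_addgt0Pr => e e0.
pose D := enorm (v - u) ^+ 2.
have D0 : 0 <= D by rewrite sqr_ge0.
(* The first entry keeps [l] inside []0, 1[]; the second gives [l * D <= eta * e], with [+ 1]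
   covering [D = 0]. *)
pose l := Num.min (2^-1) (eta * e / (D + 1)).
have l0 : 0 < l.
  by rewrite lt_min invr_gt0 ltr0n/= divr_gt0 ?mulr_gt0// ltr_wpDl.
have l1 : l < 1.
  by apply: (@le_lt_trans _ _ 2^-1); [rewrite ge_min lexx|rewrite invf_lt1 ?ltr1n].
have lD : l * D <= eta * e.
  have : l <= eta * e / (D + 1) by rewrite ge_min lexx orbT.
  rewrite ler_pdivlMr ?ltr_wpDl//; apply: le_trans.
  by rewrite ler_pM2l// lerDl.
have := fconv v u l; rewrite l0 l1 => /(_ isT).
rewrite fvE -(fineK fu) -!EFinM -EFinD => fc.
have /= := le_trans (minu (l *: v + (1 - l) *: u)) (leeD2r _ fc).
rewrite -{1}(fineK fu) -!EFinD lee_fin.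
have -> : l *: v + (1 - l) *: u - y = l *: (v - u) + (u - y).
  by apply/rowP => i; rewrite !mxE; ring.
rewrite !sqr_enorm; move: lD; rewrite /D sqr_enorm.
have -> : y - u = - (u - y) by rewrite opprB.
move: (v - u) (u - y) => z d.
rewrite !dotvE (dotvC d z).
set zz := dotv z z; set zd := dotv z d; set dd := dotv d d; move=> lD.
set b := fine (f u) => H.
have : l * (b - a) <= l * (eta^-1 * zd + (2 * eta)^-1 * (l * zz)).
  by move: H; lra.
rewrite ler_pM2l// => H2.
have : (2 * eta)^-1 * (l * zz) <= e.
  rewrite mulrC ler_pdivrMr ?mulr_gt0//; apply: le_trans lD _.
  by rewrite mulrC ler_pM2l// ler_peMl ?ltW// ltr1n.
move: H2; rewrite invfM; lra.
Qed.

End Subgradient.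

(* Here [p], [q] stand for the gradients of the smooth part at [w] and [u],
   and [Gu], [Gu'] for its values at [u] and [u']. *)
Lemma forward_backward_step {R : realType} {n : nat} (f : 'rV[R]_n -> \bar R)
    (beta eta L Gu Gu' : R) (u u' z w p q : 'rV[R]_n) :
  0 <= beta -> 0 < eta -> 0 <= L ->
  f u \is a fin_num -> convex_subgrad f u' (eta^-1 *: (w - u') - p) ->
  enorm (u' - u) <= L * enorm (w - z) ->
  enorm (q - p) <= beta * enorm (u - w) ->
  Gu' - Gu - dotv q (u' - u) <= beta * enorm (u' - u) ^+ 2 ->
  (fine (f u') + Gu' + (2 * eta)^-1 * enorm (u' - w) ^+ 2)
  - (fine (f u) + Gu + (2 * eta)^-1 * enorm (u - z) ^+ 2) <=
    beta * L * enorm (w - z) * enorm (u - z)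
    - eta^-1 * dotv (u - z) (w - z)
    + (beta * L + eta^-1 * (L + 1) + beta * L ^+ 2) * enorm (w - z) ^+ 2.
Proof.
move=> beta_ge0 eta_gt0 L0 fu [fu' /(_ u)]; rewrite -(fineK fu) lee_fin => sub lipu.
move=> pq tay.
have ie0 : 0 <= eta^-1 by rewrite invr_ge0 ltW.
pose d := enorm (w - z); have d0 : 0 <= d := enorm_ge0 _.
(* The subgradient carries [p], the gradient at [w], whereas the smooth part is expanded at [u].
   This mismatch produces the only first-order loss, [beta * L * d * enorm (u - z)]. *)
have gg : dotv (q - p) (u' - u) <= beta * (enorm (u - z) + d) * (L * d).
  apply: le_trans (dotv_le _ _) _; apply: ler_pM; rewrite ?enorm_ge0//.
  apply: le_trans pq _; rewrite ler_wpM2l//.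
  by rewrite /d (enormB w); exact: enorm_triangle.
have uu : beta * enorm (u' - u) ^+ 2 <= beta * (L * d) ^+ 2.
  by rewrite ler_wpM2l// lerXn2r ?nnegrE ?mulr_ge0 ?enorm_ge0.
have c1 : - dotv (u' - u) (w - z) <= L * d * d.
  rewrite -dotvNl; apply: le_trans (dotv_le _ _) _; rewrite enormN.
  by rewrite ler_wpM2r.
(* Convexity of the square. Multiplied by [(2 * eta)^-1], its term in [dotv (u' - w) (u' - u)]
   cancels the one in the subgradient inequality [sub]; the other becomes, by [uw], the first-order
   decrease up to quadratic terms. *)
have sq : enorm (u' - w) ^+ 2 - enorm (u - z) ^+ 2 <=
    2 * (dotv (u' - w) (u' - u) - dotv (u' - w) (w - z)).
  have -> : u - z = (u' - w) - ((u' - u) - (w - z)).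
    by rewrite [u' - u - _]subrACA subKr.
  move: (u' - w) (u' - u) (w - z) => a b c; have := dotv_ge0 (b - c).
  rewrite !sqr_enorm !dotvE (dotvC b a) (dotvC c a); lra.
have sq' := ler_wpM2l (ltac:(by rewrite invr_ge0 mulr_ge0// ltW) : 0 <= (2 * eta)^-1) sq.
have e2 : (2 * eta)^-1 * (2 * (dotv (u' - w) (u' - u) - dotv (u' - w) (w - z)))
   = eta^-1 * (dotv (u' - w) (u' - u) - dotv (u' - w) (w - z)).
  by rewrite invfM; field; rewrite gt_eqF.
have uw : dotv (u' - w) (w - z) = dotv (u - z) (w - z) + dotv (u' - u) (w - z) - d ^+ 2.
  rewrite /d sqr_enorm; have {1}-> : u' - w = (u - z) + (u' - u) - (w - z).
    by apply/rowP => i; rewrite !mxE; ring.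
  by move: (u - z) (u' - u) (w - z) => a b c; rewrite !dotvDl dotvNl.
have c1' := ler_wpM2l ie0 c1.
rewrite -(opprB u' u) -(opprB u' w) dotvNr !dotvDl dotvZl !dotvNl in sub.
rewrite dotvDl dotvNl in gg.
rewrite e2 uw in sq'.
rewrite /= -/d; move: sub tay uu c1' gg sq'.
move: (dotv p _) (dotv q _) (dotv (u' - w) _) (dotv (u - z) _).
move: (dotv (u' - u) (w - z)) (enorm (u - z)) (enorm (u' - w)) (enorm (u' - u)).
move: (fine (f u)) (fine (f u')) eta^-1 (2 * eta)^-1.
clearbody d; clear; move=> F1 F2 e1 e2 D5 N1 N2 N3 D1 D2 D3 D4; lra.
Qed.


(** * Proximal points, the forward-backward map and its energy *)

Section ForwardBackward.
Context {R : realType} {n : nat}.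
Context (f : 'rV[R]_n -> \bar R) (g : 'rV[R]_n -> R) (beta eta : R).
Context (f_proper : proper_fun f) (f_convex : econvex f)
  (f_lsc : lower_semicontinuous f)
  (g_diff : forall u, differentiable g u)
  (beta_ge0 : 0 <= beta)
  (g_lip : forall u v, enorm (grad g u - grad g v) <= beta * enorm (u - v))
  (eta_gt0 : 0 < eta).
Implicit Types (u v w p x y z : 'rV[R]_n).

Let taylor u v := ler_normlP _ _ (taylor_le g beta u v g_diff beta_ge0 g_lip).

Lemma subgrad_fg_sum u p : convex_subgrad f u p ->
  limiting_subdiff (fg_sum f g) u (p + grad g u).
Proof.
move=> [fu fp]; apply: frechet_limiting.
apply: (@frechet_subdiff_quadratic _ _ _ _ _ beta).
  by rewrite /fg_sum fin_numD fu.
move=> y; rewrite /fg_sum -{1}(fineK fu) -EFinD/=.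
have [+ _] := taylor u y; have := fp y; case: (f y) => [r| |]//.
  by rewrite -EFinD !lee_fin dotvDl; lra.
by move=> _ _; rewrite leey.
Qed.

(** The vector added to [(p, 0)] is the gradient of [g(u) + enorm (u - x) ^+ 2 / (2 * eta)] in
    [(u, x)]. The coupling is convex, so its second-order remainder is nonnegative ([h3]) and only
    the Taylor error of [g] has to be absorbed. *)
Lemma subgrad_regH u x p : convex_subgrad f u p ->
  limiting_subdiff (on_concat (regH f g eta)) (row_mx u x)
    (row_mx (p + grad g u + eta^-1 *: (u - x)) (eta^-1 *: (x - u))).
Proof.
move=> [fu fp]; apply: frechet_limiting.
have HE : on_concat (regH f g eta) (row_mx u x) =
    (fine (f u) + g u + (2 * eta)^-1 * enorm (u - x) ^+ 2)%:E.
  by rewrite /on_concat /regH /fg_sum row_mxKl row_mxKr !EFinD fineK.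
apply: (@frechet_subdiff_quadratic _ _ _ _ _ beta); rewrite HE//= => w.
rewrite -(hsubmxK w); move: (lsubmx w) (rsubmx w) => {w} y z.
rewrite opp_row_mx add_row_mx dotv_row_mx enorm_row_mx.
rewrite /on_concat /regH /fg_sum row_mxKl row_mxKr.
have [+ _] := taylor u y; have := fp y; case: (f y) => [r| |]//; last by move=> _ _; rewrite leey.
rewrite -!EFinD !lee_fin; move=> h1 h2.
have h3 : 0 <= (2 * eta)^-1 * dotv ((y - z) - (u - x)) ((y - z) - (u - x)).
  by rewrite mulr_ge0 ?dotv_ge0// invr_ge0 mulr_ge0 ?ltW.
have h4 : 0 <= beta * enorm (z - x) ^+ 2 by rewrite mulr_ge0 ?sqr_ge0.
have h5 : dotv (p + grad g u + eta^-1 *: (u - x)) (y - u) +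
          dotv (eta^-1 *: (x - u)) (z - x) =
  dotv p (y - u) + dotv (grad g u) (y - u) +
  (2 * eta)^-1 * (2 * dotv (u - x) ((y - z) - (u - x))).
  have -> : x - u = - (u - x) by rewrite opprB.
  rewrite [y - z - _]subrACA.
  move: (u - x) (y - u) (z - x) => a b d.
  by rewrite !dotvE; field; rewrite gt_eqF.
have h6 : enorm (y - z) ^+ 2 = enorm (u - x) ^+ 2 +
    2 * dotv (u - x) ((y - z) - (u - x)) + dotv ((y - z) - (u - x)) ((y - z) - (u - x)).
  rewrite !sqr_enorm; move: (y - z) (u - x) => a b.
  by rewrite !dotvE (dotvC a b); ring.
by move: h1 h2 h3 h4; rewrite h5 h6; lra.
Qed.

Context (fg_bounded_below : exists c : R, forall u, (c%:E <= fg_sum f g u)%E)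
  (eta_beta : eta * beta * (3 + eta * beta) < 1).

(* The minimized function is coercive because [f >= c - g] and [g] grows at most
   like [beta * |u|^2], with [beta < 1 / (2 * eta)]. *)
Lemma prox_subgrad y :
  convex_subgrad f (prox eta f y) (eta^-1 *: (y - prox eta f y)).
Proof.
apply: argmin_prox_subgrad => //; rewrite /prox; case: xgetP => // noarg.
suff [u hu] : exists u, argmin (fun v => (f v + ((2 * eta)^-1 * enorm (v - y) ^+ 2)%:E)%E) u.
  by have := noarg u hu.
have [fny [v0 fv0]] := f_proper; have [c hc] := fg_bounded_below.
set h := (X in argmin X).
have hv0 : (h v0 < +oo)%E by rewrite /h lte_add_pinfty// ltry.
pose G := enorm (grad g y).
pose kap := (2 * eta)^-1 - beta.
have kap0 : 0 < kap.
  rewrite /kap subr_gt0 -[ltRHS]div1r ltr_pdivlMr ?mulr_gt0//.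
  have := mulr_ge0 (ltW eta_gt0) beta_ge0; move: eta_beta; nra.
pose A := fine (h v0) - (c - g y).
have G0 : 0 <= G := enorm_ge0 _.
have Ag : 0 <= (G + 1 + `|A|) / kap by rewrite divr_ge0 ?(ltW kap0)// ?addr_ge0.
apply: (@lsc_argmin _ _ h v0 (enorm y + (G + 1 + `|A|) / kap + 1)) => //.
- by move=> u; rewrite /h adde_eq_ninfty negb_or fny.
- apply: lsc_addl => //; apply: continuous_quadratic_bound => u.
  exists ((2 * eta)^-1 * (2 * enorm (u - y))), ((2 * eta)^-1).
  have k0 : 0 <= (2 * eta)^-1 by rewrite invr_ge0 mulr_ge0// ltW.
  split; first by rewrite !mulr_ge0// enorm_ge0.
  split=> // v; rewrite -mulrBr normrM ger0_norm// -mulrA -mulrDr ler_wpM2l//.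
  have -> : v - y = (v - u) + (u - y) by rewrite subrKA.
  move: (v - u) (u - y) => a b; rewrite !sqr_enorm !dotvE (dotvC b a).
  have -> : dotv a a + dotv a b + (dotv a b + dotv b b) - dotv b b
          = 2 * dotv a b + dotv a a by ring.
  apply: le_trans (ler_normD _ _) _; rewrite (ger0_norm (dotv_ge0 a)) lerD2r.
  by rewrite normrM ger0_norm// -mulrA ler_wpM2l// (le_trans (cauchy_schwarz _ _))// mulrC.
move=> u hu; suff : enorm (u - y) <= (G + 1 + `|A|) / kap + 1.
  by have := enormD (u - y) y; rewrite subrK; lra.
have hv0f : h v0 = (fine (h v0))%:E.
  by rewrite fineK// fin_numE (lt_eqF hv0) andbT /h adde_eq_ninfty negb_or fny.
move: hu; rewrite hv0f /h => hu.
have [fu fuE] : exists r, f u = r%:E.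
  move: hu (fny u); case: (f u) => [r| |]//; first by exists r.
move: hu (hc u); rewrite /fg_sum fuE -!EFinD !lee_fin => hu cu.
have [tu _] := taylor y u; have dg := dotv_le (grad g y) (u - y).
move: hu cu tu dg; rewrite -/G.
move: (enorm_ge0 (u - y)); set r := enorm (u - y) => r0 hu cu tu dg.
(* Combines [h u <= h v0], [f u >= c - g u] and [g u <= g y + G * r + beta * r ^+ 2]. *)
have key : kap * r ^+ 2 - G * r <= A.
  have [_ tu2] := taylor y u; move: tu2; rewrite -/r /kap /A; lra.
rewrite leNgt; apply/negP => rB.
have r1 : 1 < r by move: rB Ag; lra.
have r2 : G + 1 + `|A| < kap * r.
  by rewrite mulrC -ltr_pdivrMr//; move: rB; lra.
have := ler_norm A.
have : kap * r - G <= kap * r ^+ 2 - G * r.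
  rewrite expr2 mulrA -mulrBl ler_peMr ?ltW//.
  by move: r2 (normr_ge0 A); lra.
by move: r2 key; lra.
Qed.

(** Monotonicity at the two proximal points reads [enorm (u - v) ^+ 2 <= dotv (y - z) (u - v)];
    Cauchy-Schwarz and a division finish. *)
Lemma prox_nonexpansive y z : enorm (prox eta f y - prox eta f z) <= enorm (y - z).
Proof.
have := convex_subgrad_monotone _ _ _ _ _ (prox_subgrad y) (prox_subgrad z).
set u := prox _ _ y; set v := prox _ _ z.
rewrite -scalerBr dotvZl pmulr_rge0 ?invr_gt0//.
rewrite subrACA.
rewrite dotvDl dotvNl subr_ge0 -sqr_enorm => h.
have := le_trans h (dotv_le _ _); have [->|n0] := eqVneq (enorm (u - v)) 0.
  by rewrite enorm_ge0.
by rewrite expr2 ler_pM2r// lt0r n0 enorm_ge0.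
Qed.

Definition fbmap z := prox eta f (z - eta *: grad g z).

Lemma fbmap_subgrad z :
  convex_subgrad f (fbmap z) (eta^-1 *: (z - fbmap z) - grad g z).
Proof.
have := prox_subgrad (z - eta *: grad g z); rewrite -/(fbmap z).
suff -> : eta^-1 *: (z - eta *: grad g z - fbmap z) = eta^-1 *: (z - fbmap z) - grad g z by [].
by rewrite addrAC scalerBr scalerA mulVf ?scale1r ?gt_eqF.
Qed.

Lemma fbmap_lip z w : enorm (fbmap z - fbmap w) <= (1 + eta * beta) * enorm (z - w).
Proof.
apply: le_trans (prox_nonexpansive _ _) _.
have -> : z - eta *: grad g z - (w - eta *: grad g w) =
  (z - w) + (- eta) *: (grad g z - grad g w).
  by rewrite subrACA -scalerBr scaleNr.
apply: le_trans (enormD _ _) _; rewrite mulrDl mul1r lerD2l enormZ normrN gtr0_norm//.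
by rewrite -mulrA ler_wpM2l// ltW.
Qed.

(** This is [H] at [(fbmap z, z)] as a real number: [f] is finite at every value of [fbmap], while
    [f z] may be infinite. *)
Definition energy z :=
  fine (f (fbmap z)) + g (fbmap z) + (2 * eta)^-1 * enorm (fbmap z - z) ^+ 2.

Lemma regH_fbmap z : on_concat (regH f g eta) (row_mx (fbmap z) z) = (energy z)%:E.
Proof.
rewrite /on_concat /regH /fg_sum row_mxKl row_mxKr !EFinD fineK//.
by case: (fbmap_subgrad z).
Qed.

(** Only the first two terms matter for the Dini derivative of the energy; [K] gathers everything
    quadratic in the displacement. *)
Lemma energy_step : exists2 K : R, 0 <= K & forall z w,
  energy w - energy z <=
    beta * (1 + eta * beta) * enorm (w - z) * enorm (fbmap z - z)
    - eta^-1 * dotv (fbmap z - z) (w - z) + K * enorm (w - z) ^+ 2.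
Proof.
set L := 1 + eta * beta.
have L0 : 0 <= L by rewrite addr_ge0 ?mulr_ge0// ltW.
have ie0 : 0 <= eta^-1 by rewrite invr_ge0 ltW.
exists (beta * L + eta^-1 * (L + 1) + beta * L ^+ 2).
  have L1 := addr_ge0 L0 ler01.
  by apply: addr_ge0; [apply: addr_ge0|]; apply: mulr_ge0 => //; exact: sqr_ge0.
move=> z w; have [fz _] := fbmap_subgrad z.
have [_ tay] := taylor (fbmap z) (fbmap w).
exact: (forward_backward_step f beta eta L _ _ _ _ z w _ _ beta_ge0 eta_gt0 L0 fz
  (fbmap_subgrad w) (fbmap_lip w z) (g_lip _ _) tay).
Qed.

End ForwardBackward.

(** * Trajectories with a Lyapunov function *)

Section Trajectory.
Context {R : realType} {n : nat} (x v : R -> 'rV[R]_n) (En : R -> R).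
Context (A B K M Lv c0 : R).
Context (A0 : 0 <= A) (AB : A < B) (K0 : 0 <= K) (M0 : 0 <= M) (Lv0 : 0 <= Lv).
Context
  (x_der : forall s, 0 <= s -> forall e, 0 < e -> exists2 d, 0 < d &
     forall t, 0 <= t -> `|t - s| < d ->
       enorm (x t - x s - (t - s) *: v s) <= e * `|t - s|)
  (v_lip : forall s t, 0 <= s -> 0 <= t ->
     enorm (v t - v s) <= Lv * enorm (x t - x s))
  (v_bd : forall t, 0 <= t -> enorm (v t) <= M)
  (En_step : forall s t, 0 <= s -> 0 <= t ->
     En t - En s <= A * enorm (x t - x s) * enorm (v s)
       - B * dotv (v s) (x t - x s) + K * enorm (x t - x s) ^+ 2)
  (En_bd : forall t, 0 <= t -> c0 <= En t).

Lemma trajectory_increment s e : 0 <= s -> 0 < e -> exists2 d, 0 < d &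
  forall t, 0 <= t -> `|t - s| < d ->
    enorm (x t - x s) <= (enorm (v s) + e) * `|t - s|.
Proof.
move=> s0 e0; have [d d0 hd] := x_der _ s0 _ e0; exists d => // t t0 ts.
have := enormD (x t - x s - (t - s) *: v s) ((t - s) *: v s).
by rewrite subrK enormZ; have := hd t t0 ts; lra.
Qed.

Lemma trajectory_continuous s e : 0 <= s -> 0 < e -> exists2 d, 0 < d &
  forall t, 0 <= t -> `|t - s| < d -> enorm (x t - x s) < e.
Proof.
move=> s0 e0; have [d d0 hd] := trajectory_increment _ _ s0 ltr01.
have v0 : 0 < enorm (v s) + 1 by rewrite ltr_wpDl ?enorm_ge0.
exists (Num.min d (e / (enorm (v s) + 1))); first by rewrite lt_min d0 divr_gt0.
move=> t t0; rewrite lt_min => /andP[/(hd t t0)]; rewrite ltr_pdivlMr//; lra.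
Qed.

Lemma dist_left_lsc y a s : 0 <= a -> a < s ->
  left_lsc a (fun t => enorm (x t - y)) s.
Proof.
move=> a0 as_ e e0; have s0 : 0 <= s := le_trans a0 (ltW as_).
have [d d0 hd] := trajectory_continuous _ _ s0 e0; exists d => // t /andP[at_ ts] std.
have := enorm_triangle (x t) (x s) y; rewrite (enormB (x s) (x t)).
have : enorm (x t - x s) < e; last by lra.
by apply: hd; [exact: le_trans at_|rewrite distrC ger0_norm// subr_ge0 ltW].
Qed.

Lemma dist_right_dini_le y s : 0 <= s ->
  right_dini_le (fun t => enorm (x t - y)) s (enorm (v s)).
Proof.
move=> s0 e e0; have [d d0 hd] := trajectory_increment _ _ s0 e0; exists d => // t st tsd.
have := enorm_triangle (x s) (x t) y.
have ts0 : 0 <= t - s by rewrite subr_ge0 ltW.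
have := hd t (le_trans s0 (ltW st)); rewrite ger0_norm// => /(_ tsd); lra.
Qed.

Lemma trajectory_lipschitz s t : 0 <= s <= t -> enorm (x t - x s) <= M * (t - s).
Proof.
move=> /andP[s0 st].
have := @right_dini_nonincreasing R ((fun t => enorm (x t - x s)) \+ (fun t => - M * t))
  s t 1 st ltr01.
rewrite /= subrr enorm0 => H; rewrite mulrBr -subr_le0.
have : enorm (x t - x s) - M * t <= 0 - M * s; last by lra.
have mN r : - M * r = - (M * r) by rewrite mulNr.
rewrite -!mN; apply: H => [r /andP[sr rt]|r /andP[sr rt] _].
  by apply: left_lscD; [exact: dist_left_lsc|exact: linear_left_lsc].
apply: (@right_dini_le_weaken _ _ _ (enorm (v r) + - M)).
  by rewrite subr_le0 v_bd// (le_trans s0).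
apply: right_dini_leD; last exact: linear_right_dini_le.
by apply: dist_right_dini_le; exact: le_trans sr.
Qed.

(** The increment inequality started at the earlier time bounds the rise of [En] by a multiple of
    the displacement, once the latter is at most 1 and its square is dominated by it. *)
Lemma energy_left_lsc a s : 0 <= a -> a < s -> left_lsc a En s.
Proof.
move=> a0 as_ e e0; have s0 : 0 <= s := le_trans a0 (ltW as_).
have ABM : 0 <= (A + B) * M by rewrite mulr_ge0// addr_ge0// ltW// (le_lt_trans A0).
have Q0 : 0 < (A + B) * M + K + 1 by rewrite ltr_wpDl// addr_ge0.
have [|d d0 hd] := trajectory_continuous s (Num.min 1 (e / ((A + B) * M + K + 1))) s0.
  by rewrite lt_min ltr01 divr_gt0.
exists d => // t /andP[at_ ts] std; have t0 : 0 <= t := le_trans a0 at_.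
have := hd t t0; rewrite distrC ger0_norm ?subr_ge0 ?(ltW ts)// => /(_ std).
rewrite lt_min ltr_pdivlMr// enormB => /andP[r1 r2].
have := En_step _ _ t0 s0; have vM := v_bd _ t0.
have := dotv_le (- v t) (x s - x t); rewrite dotvNl enormN.
have := enorm_ge0 (x s - x t); move: r1 r2; set r := enorm (x s - x t) => r1 r2 r0 dv.
have vMr := ler_wpM2l r0 vM.
have B0 : 0 <= B by rewrite ltW// (le_lt_trans A0).
have h1 := ler_wpM2l B0 (le_trans dv (ler_wpM2r r0 vM)).
have h2 := ler_wpM2l A0 vMr.
have h3 : K * r ^+ 2 <= K * r by rewrite ler_wpM2l// expr2 ler_piMl// ltW.
lra.
Qed.

Lemma energy_right_dini_le s : 0 <= s ->
  right_dini_le En s (- ((B - A) * enorm (v s) ^+ 2)).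
Proof.
move=> s0 e e0; set V := enorm (v s); have V0 : 0 <= V := enorm_ge0 _.
have B0 : 0 <= B by rewrite ltW// (le_lt_trans A0).
(* Half of [e] pays for the differentiability remainder in the two first-order terms ([Q]), half for
   the quadratic term ([S]). Since [e1 <= 1], the displacement is at most [(V + 1) * (t - s)]. *)
pose Q := (A + B) * V + 1; have Q0 : 0 < Q by rewrite ltr_wpDl// mulr_ge0// addr_ge0.
pose S := K * (V + 1) ^+ 2 + 1; have S0 : 0 < S by rewrite ltr_wpDl// mulr_ge0// sqr_ge0.
pose e1 := Num.min 1 (e / 2 / Q).
have e10 : 0 < e1 by rewrite lt_min ltr01 !divr_gt0.
have [d d0 hd] := x_der _ s0 _ e10.
exists (Num.min d (e / 2 / S)); first by rewrite lt_min d0 !divr_gt0.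
move=> t st; rewrite lt_min ltr_pdivlMr// => /andP[td tS].
have ts0 : 0 < t - s by rewrite subr_gt0.
have t0 : 0 <= t := le_trans s0 (ltW st).
have := hd t t0; rewrite gtr0_norm// => /(_ td) hr.
have e11 : e1 <= 1 by rewrite ge_min lexx.
have e1Q : e1 * Q <= e / 2 by rewrite -ler_pdivlMr// ge_min lexx orbT.
have := En_step _ _ s0 t0; rewrite -/V.
set r := x t - x s - (t - s) *: v s in hr.
have xE : x t - x s = (t - s) *: v s + r by rewrite /r [RHS]addrC subrK.
have dx : enorm (x t - x s) <= (V + e1) * (t - s).
  rewrite xE; apply: le_trans (enormD _ _) _; rewrite enormZ gtr0_norm// -/V; lra.
have dv : - dotv (v s) (x t - x s) <= e1 * (t - s) * V - (t - s) * V ^+ 2.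
  rewrite xE dotvDr dotvZr -sqr_enorm -/V.
  have := dotv_le (- v s) r; rewrite dotvNl enormN -/V.
  have := ler_wpM2l V0 hr; lra.
have h1 := ler_wpM2r V0 (ler_wpM2l A0 dx).
have h2 := ler_wpM2l B0 dv.
have h3 : K * enorm (x t - x s) ^+ 2 <= K * (V + 1) ^+ 2 * (t - s) * (t - s).
  rewrite -2!mulrA ler_wpM2l//.
  have -> : (V + 1) ^+ 2 * ((t - s) * (t - s)) = ((V + 1) * (t - s)) ^+ 2 by ring.
  rewrite lerXn2r ?nnegrE ?enorm_ge0//.
    by apply: mulr_ge0; [exact: addr_ge0|exact: ltW].
  by apply: le_trans dx _; rewrite ler_pM2r// lerD2l.
have h4 : (t - s) * (K * (V + 1) ^+ 2 * (t - s)) <= (t - s) * (e / 2).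
  by rewrite ler_pM2l//; move: tS; rewrite /S; lra.
have h5 : (t - s) * (e1 * ((A + B) * V)) <= (t - s) * (e / 2).
  by rewrite ler_pM2l//; move: e1Q; rewrite /Q; lra.
move: h1 h2 h3 h4 h5; set D := dotv _ _; set N := enorm (x t - x s).
move: D N => D N; lra.
Qed.

Lemma energy_decrease a b m : 0 <= a <= b -> 0 <= m ->
  (forall t, a <= t <= b -> m <= enorm (v t)) ->
  En b + (B - A) * m ^+ 2 * (b - a) <= En a.
Proof.
move=> /andP[a0 ab] m0 hm.
have := @right_dini_nonincreasing R (En \+ (fun t => (B - A) * m ^+ 2 * t)) a b 1 ab ltr01.
move=> /= H; suff : En b + (B - A) * m ^+ 2 * b <= En a + (B - A) * m ^+ 2 * a by lra.
apply: H => [r /andP[ar rb]|r /andP[ar rb] _].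
  by apply: left_lscD; [exact: energy_left_lsc|exact: linear_left_lsc].
apply: (@right_dini_le_weaken _ _ _ (- ((B - A) * enorm (v r) ^+ 2) + (B - A) * m ^+ 2)).
  rewrite addrC subr_le0 ler_wpM2l ?subr_ge0 ?(ltW AB)//.
  by rewrite lerXn2r ?nnegrE ?enorm_ge0// hm// ar ltW.
apply: right_dini_leD; last exact: linear_right_dini_le.
by apply: energy_right_dini_le; exact: le_trans ar.
Qed.

Lemma energy_nonincreasing a b : 0 <= a <= b -> En b <= En a.
Proof.
move=> ab; have := energy_decrease _ _ 0 ab (lexx _) (fun t _ => enorm_ge0 _).
by rewrite expr0n mulr0 mul0r addr0.
Qed.

Definition energy_limit := inf [set En t | t in [set t | 0 <= t]].

Let has_inf_energy : has_inf [set En t | t in [set t | 0 <= t]].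
Proof.
split; first by exists (En 0), 0 => /=.
by exists c0 => _ [t t0 <-]; exact: En_bd.
Qed.

Lemma energy_limit_le t : 0 <= t -> energy_limit <= En t.
Proof. by move=> t0; apply: ge_inf; [case: has_inf_energy|exists t]. Qed.

Lemma energy_cvg e : 0 < e -> exists2 T, 0 <= T &
  forall t, T <= t -> En t < energy_limit + e.
Proof.
move=> e0; have [_ [T T0 <-] hT] := inf_adherent e0 has_inf_energy.
exists T => // t Tt; apply: le_lt_trans hT.
by apply: energy_nonincreasing; rewrite T0.
Qed.

(** A speed at least [e] at a late time would stay above [e / 2] for a fixed duration [d], since the
    velocity is Lipschitz in time; the energy would then drop by more than what separates it from
    its limit. *)
Lemma velocity_vanishes e : 0 < e -> exists2 T, 0 <= T &
  forall t, T <= t -> enorm (v t) < e.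
Proof.
move=> e0; pose d := e / 2 / (Lv * M + 1).
have LM : 0 < Lv * M + 1 by rewrite ltr_wpDl// mulr_ge0.
have d0 : 0 < d by rewrite !divr_gt0.
have c1 : 0 < (B - A) * (e / 2) ^+ 2 * d.
  apply: mulr_gt0 => //; apply: mulr_gt0; first by rewrite subr_gt0.
  by rewrite exprn_gt0// divr_gt0.
have [T T0 hT] := energy_cvg _ c1; exists T => // t Tt.
rewrite ltNge; apply/negP => ve; have t0 := le_trans T0 Tt.
have td : 0 <= t + d by rewrite addr_ge0// ltW.
have := energy_decrease t (t + d) (e / 2).
rewrite t0 lerDl (ltW d0) => /(_ isT); rewrite divr_ge0 ?(ltW e0)// => /(_ isT) H.
have : forall r, t <= r <= t + d -> e / 2 <= enorm (v r).
  move=> r /andP[tr rtd]; have r0 := le_trans t0 tr.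
  have := enormD (v t - v r) (v r); rewrite subrK (enormB (v t)).
  have := v_lip _ _ t0 r0; have := trajectory_lipschitz t r; rewrite t0 tr => /(_ isT) h.
  have rd : r - t <= d by lra.
  have h1 := ler_wpM2l Lv0 (le_trans h (ler_wpM2l M0 rd)).
  have : Lv * (M * d) <= e / 2.
    have : (Lv * M + 1) * d = e / 2 by rewrite mulrC divfK ?gt_eqF.
    lra.
  lra.
move=> /H; have := energy_limit_le _ td; have := hT _ Tt; lra.
Qed.

(** * Trapping and finite length from a function [Phi] whose decrease dominates the speed near
    [xb] *)

Context (xb : 'rV[R]_n) (rho T : R) (Phi : R -> R).
Context (rho0 : 0 < rho) (T0 : 0 <= T)
  (Phi_ge0 : forall t, T <= t -> 0 <= Phi t)
  (Phi_noninc : forall s t, T <= s -> s <= t -> Phi t <= Phi s)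
  (Phi_dini : forall s, T <= s -> enorm (x s - xb) < rho ->
     right_dini_le Phi s (- enorm (v s)))
  (Phi_small : forall e, 0 < e ->
     exists t, [/\ T <= t, enorm (x t - xb) < e & Phi t < e]).

Let Phi_left_lsc a s : T <= a -> left_lsc a Phi s.
Proof.
move=> Ta e e0; exists 1 => // t /andP[at_ ts] _.
apply: (le_trans (Phi_noninc _ _ (le_trans Ta at_) (ltW ts))).
by rewrite lerDl ltW.
Qed.

Lemma trajectory_cvg e : 0 < e -> exists2 T1, T <= T1 &
  forall t, T1 <= t -> enorm (x t - xb) < e.
Proof.
move=> e0; wlog er : e e0 / e <= rho.
  move=> H; have [||T1 TT1 hT1] := H (Num.min e rho); rewrite ?lt_min ?e0// ?ge_min ?lexx ?orbT//.
  by exists T1 => // t /hT1; rewrite lt_min => /andP[].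
have e30 : 0 < e / 3 by rewrite divr_gt0.
have [t0 [Tt0 xt0 pt0]] := Phi_small _ e30; exists t0 => // t t0t.
(* With margin [k = e / 3]: as long as the sum is at most [Phi t0 + e / 3 < 2 * e / 3], the point
   [x r] is within [e <= rho] of [xb], which is exactly where [Phi_dini] applies. *)
have := @right_dini_nonincreasing R ((fun t => enorm (x t - x t0)) \+ Phi) t0 t (e / 3) t0t e30.
have t00 := le_trans T0 Tt0.
rewrite /= subrr enorm0 add0r => H.
have := enorm_triangle (x t0) (x t) xb; have := Phi_ge0 _ (le_trans Tt0 t0t).
suff : enorm (x t - x t0) + Phi t <= Phi t0 by lra.
apply: H => [r /andP[tr rt]|r /andP[tr rt] hr].
  by apply: left_lscD; [exact: dist_left_lsc|exact: Phi_left_lsc].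
have Tr := le_trans Tt0 tr.
rewrite -(subrr (enorm (v r))); apply: right_dini_leD.
  by apply: dist_right_dini_le; exact: le_trans tr.
apply: Phi_dini => //; apply: lt_le_trans er.
have := enorm_triangle (x t0) (x r) xb; have := Phi_ge0 _ Tr; lra.
Qed.

(** [Y] will be the running integral of the speed; the bound [Phi a] is uniform in [b], hence gives
    integrability. *)
Lemma trajectory_length (Y : R -> R) a b :
  T <= a -> a <= b ->
  (forall t, a <= t -> enorm (x t - xb) < rho) ->
  (forall s, a < s -> left_lsc a Y s) ->
  (forall s, a <= s -> right_dini_le Y s (enorm (v s))) ->
  Y b - Y a <= Phi a.
Proof.
move=> Ta ab near lY dY.
have := @right_dini_nonincreasing R (Y \+ Phi) a b 1 ab ltr01 => /= H.
have := Phi_ge0 _ (le_trans Ta ab).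
suff : Y b + Phi b <= Y a + Phi a by lra.
apply: H => [r /andP[tr rt]|r /andP[tr rt] hr].
  by apply: left_lscD; [exact: lY|exact: Phi_left_lsc].
rewrite -(subrr (enorm (v r))); apply: right_dini_leD; first exact: dY.
by apply: Phi_dini; [exact: le_trans tr|exact: near].
Qed.

End Trajectory.

(** * Desingularizing functions, integrals and limits *)

Section RealAnalysis.
Context {R : realType}.
Implicit Types (phi h y : R -> R).

Lemma derivable_quotient h s e : derivable h s 1 -> 0 < e ->
  exists2 d, 0 < d & forall t, `|t - s| < d -> t != s ->
    `|derive1 h s - (h t - h s) / (t - s)| < e.
Proof.
move=> dh e0; have := dh; rewrite /derivable => /cvgrPdist_lt/(_ _ e0).
rewrite -/(derive h s 1) -derive1E /dnbhs => -[d /= d0 hd].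
exists d => // t td ts; have ts0 : t - s != 0 by rewrite subr_eq0.
have := hd (t - s); rewrite /= sub0r normrN => /(_ td ts0).
by rewrite [_ *: 1]mulr1 subrK mulrC.
Qed.

Lemma derivable_right_dini_le h s : derivable h s 1 -> right_dini_le h s (derive1 h s).
Proof.
move=> dh e e0; have [d d0 hd] := derivable_quotient _ _ _ dh e0; exists d => // t st tsd.
have ts0 : 0 < t - s by rewrite subr_gt0.
have := hd t; rewrite gtr0_norm// gt_eqF// => /(_ tsd isT).
rewrite ltr_norml => /andP[hq _].
have : (h t - h s) / (t - s) < derive1 h s + e by lra.
by rewrite ltr_pdivrMr//; lra.
Qed.

Lemma derivable_left_lsc a h s : derivable h s 1 -> left_lsc a h s.
Proof.
move=> /derivable1_diffP/differentiable_continuous/cvgrPdist_lt hc e e0.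
have [d /= d0 hd] := hc e e0; exists d => // t /andP[_ ts] std.
have := hd t; rewrite /= gtr0_norm ?subr_gt0// => /(_ std).
by rewrite ltr_norml => /andP[_]; lra.
Qed.

Section Theta.
Context (mu : \bar R) (phi : R -> R) (mu0 : (0 < mu)%E) (phiT : Theta mu phi).

(** The difference quotient of [phi] on a short segment from [b] towards [a] is close to the
    derivative and, by concavity, comparable with the chord to [a]. The endpoint [a = 0], which the
    energy gap may reach, is allowed. *)
Lemma Theta_tangent a b : 0 <= a -> (a%:E < mu)%E -> 0 < b -> (b%:E < mu)%E ->
  phi a <= phi b + derive1 phi b * (a - b).
Proof.
move=> a0 amu b0 bmu; have [_ conc _ _ [der _ _]] := phiT.
have [->|ab] := eqVneq a b; first by rewrite subrr mulr0 addr0.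
have N0 : 0 < `|a - b| by rewrite normr_gt0 subr_eq0.
apply/ler_addgt0Pr => e e0.
have [|d d0 hd] := derivable_quotient phi b (e / `|a - b|) (der b (conj b0 bmu)).
  by rewrite divr_gt0.
pose l := Num.min 1 (d / 2 / `|a - b|).
have l0 : 0 < l by rewrite lt_min ltr01 !divr_gt0.
have l1 : l <= 1 by rewrite ge_min lexx.
have tE : l * a + (1 - l) * b - b = l * (a - b) by ring.
have abn : a - b != 0 by rewrite subr_eq0.
have ld : l * `|a - b| < d.
  have : l <= d / 2 / `|a - b| by rewrite ge_min lexx orbT.
  by rewrite ler_pdivlMr//; lra.
have lab : l * (a - b) != 0 by apply: mulf_neq0 => //; exact: lt0r_neq0.
have := hd (l * a + (1 - l) * b).
rewrite tE normrM (gtr0_norm l0) => /(_ ld).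
rewrite -subr_eq0 tE => /(_ lab).
have := conc a b l (conj a0 amu) (conj (ltW b0) bmu).
rewrite (ltW l0) l1 => /(_ isT); set q := phi (l * a + _) => cq.
rewrite -(ltr_pM2r N0) divfK ?gt_eqF// -normrM mulrBl => H.
have E : (q - phi b) / (l * (a - b)) * (a - b) = (q - phi b) / l.
  by field; rewrite abn gt_eqF.
rewrite E ltr_norml in H; move: H => /andP[H _].
have : phi a - phi b <= (q - phi b) / l by rewrite ler_pdivlMr//; lra.
lra.
Qed.

Lemma Theta_nondecreasing a b : 0 <= a -> a <= b -> (b%:E < mu)%E -> phi a <= phi b.
Proof.
move=> a0 ab bmu; have [_ _ _ _ [_ _ der]] := phiT.
have [<-//|neq] := eqVneq a b.
have b0 : 0 < b by rewrite (le_lt_trans a0)// lt_neqAle neq.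
have amu : (a%:E < mu)%E by apply: le_lt_trans bmu; rewrite lee_fin.
apply: le_trans (Theta_tangent _ _ a0 amu b0 bmu) _.
by rewrite gerDl mulr_ge0_le0 ?subr_le0// ltW// der.
Qed.

Lemma Theta_small e : 0 < e -> exists2 d, 0 < d &
  forall s, 0 <= s -> s < d -> (s%:E < mu)%E -> phi s < e.
Proof.
move=> e0; have [_ _ cont phi0 _] := phiT.
have D0 : [set s : R | 0 <= s /\ (s%:E < mu)%E] 0 by rewrite /= lexx.
have : phi @ within [set s : R | 0 <= s /\ (s%:E < mu)%E] (nbhs 0) --> phi 0.
  by have := cont 0; rewrite /continuous_at/= nbhs_subspace_in.
move=> /cvgrPdist_lt/(_ _ e0).
rewrite phi0 => -[d /= d0 hd]; exists d => // s s0 sd smu.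
have := hd s; rewrite /= !sub0r !normrN ger0_norm// => /(_ sd (conj s0 smu)).
by move=> /(le_lt_trans (ler_norm _)).
Qed.

End Theta.

Lemma lipschitz_continuous y (L : R) : 0 <= L ->
  (forall s t, `|y t - y s| <= L * `|t - s|) -> continuous y.
Proof.
move=> L0 hL s; apply/cvgrPdist_lt => e e0.
exists (e / (L + 1)) => /=; first by rewrite divr_gt0// ltr_wpDl.
move=> t; rewrite /= ltr_pdivlMr ?ltr_wpDl// => H.
apply: le_lt_trans (hL _ _) _; apply: le_lt_trans H.
by rewrite mulrC ler_wpM2l// lerDl.
Qed.

Lemma continuous_integrable_itv y (a b : R) : continuous y ->
  lebesgue_measure.-integrable `[a, b] (EFin \o y).
Proof.
move=> yc; apply: continuous_compact_integrable; first exact: segment_compact.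
exact: continuous_subspaceT.
Qed.

Lemma integral_derivable y (s : R) : continuous y -> 0 < s ->
  derivable (fun t : R => \int[lebesgue_measure]_(r in `[0, t]) y r)%R s 1 /\
  derive1 (fun t : R => \int[lebesgue_measure]_(r in `[0, t]) y r)%R s = y s.
Proof.
move=> yc s0.
have := @continuous_FTC1 R y (BLeft 0) s (s + 1) (ltac:(by rewrite ltrDl))
  (continuous_integrable_itv y 0 (s + 1) yc).
by move=> /= /(_ s0 (yc s)).
Qed.

Lemma integral_lty_bounded y (a C : R) : continuous y -> (forall t, 0 <= y t) ->
  0 <= a ->
  (forall b, a <= b -> (\int[lebesgue_measure]_(r in `[0, b]) y r)%R <= C) ->
  (\int[lebesgue_measure]_(t in `[0%R, +oo[) (y t)%:E < +oo)%E.
Proof.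
move=> yc y0 a0 hC; have my : measurable_fun setT y.
  by apply: measurable_realfun.continuous_measurable_fun.
rewrite ge0_integral_ereal_sup//; apply: (@le_lt_trans _ _ C%:E); last by rewrite ltry.
apply: ge_ereal_sup => _ [i _ <-].
pose b := Num.max a i.+1%:R.
apply: (@le_trans _ _ (\int[lebesgue_measure]_(x in `[0%R, b]) (y x)%:E)%E).
  apply: ge0_subset_integral => //.
  - by apply/measurable_realfun.measurable_EFinP; exact: measurable_funS my.
  - by move=> t _; rewrite lee_fin.
  - by apply: subset_itvl; rewrite bnd_simp /b le_max lexx orbT.
have ab : a <= b by rewrite /b le_max lexx.
have := hC b ab; rewrite /Rintegral.
by rewrite -lee_fin fineK// integrable_fin_num//; exact: continuous_integrable_itv.
Qed.

End RealAnalysis.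

Section Limits.
Context {R : realType} {n : nat}.

Lemma bounded_cluster (x : R -> 'rV[R]_n) (M : R) :
  (forall t, 0 <= t -> enorm (x t) <= M) ->
  exists xb, forall e T, 0 < e -> exists2 t, T <= t & enorm (x t - xb) < e.
Proof.
move=> xM; have FM : (x @ +oo) [set u | enorm u <= M].
  by exists 0; split; [exact: num_real|move=> t /ltW; exact: xM].
have [xb [_ cl]] := compact_enorm_ball M _ _ FM; exists xb => e T e0.
have FA : (x @ +oo) [set x t | t in [set t | T <= t]].
  by exists T; split; [exact: num_real|move=> t /ltW Tt; exists t].
have [_ [[t Tt <-] xt]] := cl _ [set u | enorm (u - xb) < e] FA
  (ltac:(by apply/nbhs_enormP; exists e)).
by exists t.
Qed.

(** Passing to the limit in the minorants gives [l + dotv pb (y - xb) <= f y], hence [l <= f xb];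
    lower semicontinuity gives the reverse. The value of [f] at [xb] is thus identified, not
    assumed. *)
Lemma convex_subgrad_limit (f : 'rV[R]_n -> \bar R) (xb pb : 'rV[R]_n) (l : R) :
  (forall u, f u != -oo%E) -> lower_semicontinuous f ->
  (forall e, 0 < e -> exists u p,
     [/\ convex_subgrad f u p, enorm (u - xb) < e, enorm (p - pb) < e &
         `|fine (f u) - l| < e]) ->
  f xb = l%:E /\ convex_subgrad f xb pb.
Proof.
move=> fny flsc near.
have sub y : ((l + dotv pb (y - xb))%:E <= f y)%E.
  move: (fny y); case fy : (f y) => [r| |]// _; last by rewrite leey.
  rewrite lee_fin; apply/ler_addgt0Pr => e e0.
  pose Q := enorm (y - xb) + enorm pb + 2.
  have Q0 : 0 < Q by rewrite ltr_wpDl// addr_ge0// enorm_ge0.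
  have [|u [p [[fu /(_ y)]]]] := near (Num.min 1 (e / Q)).
    by rewrite lt_min ltr01 divr_gt0.
  rewrite fy lee_fin; set d := Num.min 1 _ => sup uxb ppb ful.
  have d1 : d <= 1 by rewrite ge_min lexx.
  have d0 : 0 < d by rewrite lt_min ltr01 divr_gt0.
  have dQ : d * Q <= e by rewrite -ler_pdivlMr// ge_min lexx orbT.
  have E : dotv pb (y - xb) = dotv p (y - u) + dotv (pb - p) (y - xb) + dotv p (u - xb).
    have -> : y - xb = (y - u) + (u - xb) by rewrite subrKA.
    by move: (y - u) (u - xb) => a b; rewrite !dotvE; ring.
  have h1 : dotv (pb - p) (y - xb) <= d * enorm (y - xb).
    apply: le_trans (dotv_le _ _) _; rewrite ler_wpM2r ?enorm_ge0//.
    by rewrite enormB ltW.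
  have h2 : dotv p (u - xb) <= (enorm pb + 1) * d.
    apply: le_trans (dotv_le _ _) _; apply: ler_pM; rewrite ?enorm_ge0 ?(ltW uxb)//.
    have := enormD (p - pb) pb; rewrite subrK; lra.
  move: ful; rewrite ltr_norml => /andP[ful _].
  by move: dQ; rewrite E /Q; lra.
have fxb : f xb = l%:E.
  apply/eqP; rewrite eq_le; apply/andP; split; last first.
    by have := sub xb; rewrite subrr dotvC dotv0l addr0.
  rewrite leNgt; apply/negP => lf.
  have [a la af] : exists2 a, l < a & (a%:E < f xb)%E.
    move: lf (fny xb); case: (f xb) => [r| |]//.
      by rewrite lte_fin => lr _; exists ((l + r) / 2); rewrite ?lte_fin; lra.
    by move=> _ _; exists (l + 1); rewrite ?ltry//; lra.
  have [V /nbhs_enormP[e e0 eV] Vf] := flsc _ _ af.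
  have [|u [p [[fu _] uxb _ ful]]] := near (Num.min e (a - l)).
    by rewrite lt_min e0 subr_gt0.
  move: uxb ful; rewrite !lt_min => /andP[/eV/Vf + _] /andP[_].
  by rewrite -(fineK fu) lte_fin ltr_norml => + /andP[_]; lra.
by split=> //; split=> [|y]; rewrite fxb.
Qed.

Lemma hl_deriv_increment (x : R -> 'rV[R]_n) (s e : R) :
  cvg (hl_quotient x s) -> 0 < e -> exists2 d, 0 < d &
    forall t, 0 <= t -> `|t - s| < d ->
      enorm (x t - x s - (t - s) *: hl_deriv x s) <= e * `|t - s|.
Proof.
rewrite /hl_deriv /hl_quotient => /cvg_enormP H e0.
have [d /= d0 hd] := H _ e0.
exists d => // t t0 ts; have [->|neq] := eqVneq t s.
  by rewrite !subrr scale0r subrr enorm0 normr0 mulr0.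
have tsn : t - s != 0 by rewrite subr_eq0.
have := hd t; rewrite /= distrC => /(_ ts neq).
rewrite in_itv/= andbT => /(_ t0); set q := lim _ => h.
have -> : x t - x s - (t - s) *: q = (t - s) *: ((t - s)^-1 *: (x t - x s) - q).
  by rewrite scalerBr scalerA divff// scale1r.
by rewrite enormZ mulrC ler_wpM2r// ltW.
Qed.

End Limits.

(** * Convergence of the forward-backward flow *)



(** The tangent inequality of the concave [phi] replaces the chain rule: the rate is at most [C / c
    * phi' * (- c * V ^+ 2) = - (phi' * C * V) * V], and the KL bound makes the bracket at least
    1. *)
Lemma desingularized_dini {R : realType} (En phi : R -> R) (mu : \bar R)
    (El c C V s : R) :
  Theta mu phi -> 0 < c -> 0 < C -> 0 <= V ->
  right_dini_le En s (- (c * V ^+ 2)) ->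
  (forall t, s <= t -> El <= En t <= En s) -> ((En s - El)%:E < mu)%E ->
  (El < En s -> 1 <= derive1 phi (En s - El) * (C * V)) ->
  right_dini_le (fun t => C / c * phi (En t - El)) s (- V).
Proof.
move=> phiT c0 C0 V0 dEn mono Emu kl.
have [Els _] := andP (mono s (lexx s)).
have CC : 0 < C / c by rewrite divr_gt0.
(* At the limit level KL says nothing. There the energy is constant from [s] on, so its decay rate
   forces [V = 0]. *)
move: Els; rewrite le_eqVlt => /predU1P[Els|Els].
  have Econst t : s <= t -> En t = El.
    by move=> /mono/andP[h1 h2]; apply: le_anti; rewrite h1 andbT Els.
  have V00 : V = 0.
    have : c * V ^+ 2 <= 0.
      apply/ler_addgt0Pr => e e0; rewrite add0r; have [d d0 hd] := dEn e e0.
      have st : s < s + d / 2 by rewrite ltrDl divr_gt0.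
      have := hd _ st; rewrite addrAC subrr add0r (Econst _ (ltW st)) -Els.
      have dd : d / 2 < d by lra.
      move=> /(_ dd); rewrite -subr_le0 opprD addrA subrr add0r oppr_le0.
      by rewrite pmulr_lge0 ?divr_gt0// addrC subr_ge0.
    rewrite pmulr_rle0// => V2; apply/eqP; rewrite -sqrf_eq0 eq_le V2.
    exact: sqr_ge0.
  move=> e e0; exists 1 => // t st _.
  by rewrite (Econst t (ltW st)) -Els V00 oppr0 add0r lerDl mulr_ge0 ?ltW ?subr_gt0.
have b0 : 0 < En s - El by rewrite subr_gt0.
have mu0 : (0 < mu)%E by apply: lt_trans Emu; rewrite lte_fin.
have p0 : 0 < derive1 phi (En s - El) by case: phiT => _ _ _ _ [_ _]; apply.
set p := derive1 phi (En s - El) in kl p0 *.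
have kp : 0 < C / c * p := mulr_gt0 CC p0.
move=> e e0; have [|d d0 hd] := dEn (e / (C / c * p)); first by rewrite divr_gt0.
exists d => // t st tsd; have [Elt Ets] := andP (mono t (ltW st)).
have tmu : ((En t - El)%:E < mu)%E.
  by apply: le_lt_trans Emu; rewrite lee_fin lerD2r.
have := Theta_tangent mu phi phiT (En t - El) (En s - El).
rewrite subr_ge0 Elt tmu b0 Emu => /(_ isT isT isT isT); rewrite -/p => tan.
have := hd t st tsd; set w := - _ + _ => hEn.
have h1 := ler_wpM2l (ltW CC) tan.
have h2 : C / c * p * (En t - En s) <= C / c * p * (w * (t - s)).
  by rewrite ler_pM2l// lerBlDl.
have wE : C / c * p * w = - (p * (C * V)) * V + e.
  by rewrite /w; field; rewrite !lt0r_neq0.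
have h3 : C / c * p * (w * (t - s)) <= (- V + e) * (t - s).
  rewrite mulrA ler_pM2r ?subr_gt0// wE lerD2r mulNr lerN2.
  by rewrite ler_peMl// kl.
move: h1 h2 h3; rewrite mulrDr mulrA.
have -> : En t - El - (En s - El) = En t - En s by lra.
lra.
Qed.

Section Convergence.
Context {R : realType} {n : nat}.
Context (f : 'rV[R]_n -> \bar R) (g : 'rV[R]_n -> R) (beta eta : R)
  (x0 : 'rV[R]_n) (x : R -> 'rV[R]_n).
Context (f_proper : proper_fun f) (f_convex : econvex f)
  (f_lsc : lower_semicontinuous f)
  (g_diff : forall u, differentiable g u)
  (beta_ge0 : 0 <= beta)
  (g_lip : forall u v, enorm (grad g u - grad g v) <= beta * enorm (u - v))
  (fg_bounded_below : exists c : R, forall u, (c%:E <= fg_sum f g u)%E)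
  (eta_gt0 : 0 < eta)
  (eta_beta : eta * beta * (3 + eta * beta) < 1)
  (x_sol : fb_solution f g eta x0 x)
  (x_bounded : exists M : R, forall t, 0 <= t -> enorm (x t) <= M).

Local Notation FB := (fbmap f g eta).
Local Notation v := (hl_deriv x).

Let FB_subgrad := fbmap_subgrad f g beta eta f_proper f_convex f_lsc g_diff
  beta_ge0 g_lip eta_gt0 fg_bounded_below eta_beta.
Let FB_lip := fbmap_lip f g beta eta f_proper f_convex f_lsc g_diff
  beta_ge0 g_lip eta_gt0 fg_bounded_below eta_beta.

Lemma velocityE t : 0 <= t -> v t = FB (x t) - x t.
Proof. by move=> t0; rewrite /fbmap; have [_ /(_ t t0) <- _] := x_sol; rewrite addrK. Qed.

Lemma solution_increment s : 0 <= s -> forall e, 0 < e -> exists2 d, 0 < d &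
  forall t, 0 <= t -> `|t - s| < d ->
    enorm (x t - x s - (t - s) *: v s) <= e * `|t - s|.
Proof.
by move=> s0 e e0; have [[/(_ s s0) xs _] _ _] := x_sol; exact: hl_deriv_increment.
Qed.

Lemma velocity_lipschitz s t : 0 <= s -> 0 <= t ->
  enorm (v t - v s) <= (2 + eta * beta) * enorm (x t - x s).
Proof.
move=> s0 t0; rewrite !velocityE// subrACA.
apply: le_trans (enormD _ _) _; rewrite enormN.
by have := FB_lip (x t) (x s); lra.
Qed.

Lemma velocity_bounded : exists2 M, 0 <= M & forall t, 0 <= t -> enorm (v t) <= M.
Proof.
have [M hM] := x_bounded; have M0 := le_trans (enorm_ge0 _) (hM 0 (lexx _)).
have L0 : 0 <= 2 + eta * beta by rewrite addr_ge0// mulr_ge0// ltW.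
exists (enorm (v 0) + (2 + eta * beta) * (M + M)).
  by apply: addr_ge0; [exact: enorm_ge0|apply: mulr_ge0 => //; exact: addr_ge0].
move=> t t0; have := enormD (v t - v 0) (v 0); rewrite subrK.
have := velocity_lipschitz 0 t (lexx _) t0.
have : enorm (x t - x 0) <= M + M.
  by apply: le_trans (enormD _ _) _; rewrite enormN; apply: lerD; exact: hM.
move=> /(ler_wpM2l L0) h1 h2 h3; apply: le_trans h3 _.
by rewrite addrC lerD2l; exact: le_trans h1.
Qed.

Lemma energy_bounded_below : exists c : R, forall z, c <= energy f g eta z.
Proof.
have [c hc] := fg_bounded_below; exists c => z.
have [fu _] := FB_subgrad z.
have := hc (FB z); rewrite /fg_sum -(fineK fu) -EFinD lee_fin => /le_trans; apply.
by rewrite lerDl mulr_ge0 ?sqr_ge0// invr_ge0 mulr_ge0// ltW.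
Qed.

(** At late times with [x t] near [xb], vanishing velocity brings [FB (x t)] near [xb] too, its
    subgradient near [- grad g xb], and its [f]-value, the energy minus [g] and the coupling, near
    [El - g xb]. *)
Lemma cluster_point_subgrad (xb : 'rV[R]_n) (El : R) :
  (forall e T, 0 < e -> exists2 t, T <= t & enorm (x t - xb) < e) ->
  (forall e, 0 < e -> exists2 T, 0 <= T & forall t, T <= t -> enorm (v t) < e) ->
  (forall e, 0 < e -> exists2 T, 0 <= T &
     forall t, T <= t -> `|energy f g eta (x t) - El| < e) ->
  f xb = (El - g xb)%:E /\ convex_subgrad f xb (- grad g xb).
Proof.
move=> clx clv clE; have [fny _] := f_proper.
apply: convex_subgrad_limit => // e e0; have e40 : 0 < e / 4 by rewrite divr_gt0.
have [d d0 gd] : exists2 d, 0 < d & forall u, enorm (u - xb) < d -> `|g xb - g u| < e / 4.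
  apply/nbhs_enormP.
  by have /differentiable_continuous/cvgrPdist_lt := g_diff xb; apply.
pose Q := eta^-1 + beta + 1.
have ie0 : 0 < eta^-1 by rewrite invr_gt0.
have Q1 : 1 <= Q by rewrite lerDr addr_ge0// ltW.
have Q0 : 0 < Q := lt_le_trans ltr01 Q1.
pose e1 := Num.min (Num.min (d / 2) 1) (e / 4 / Q).
have e10 : 0 < e1 by rewrite !lt_min ltr01 !divr_gt0.
have e1d : e1 <= d / 2 by rewrite !ge_min lexx.
have e11 : e1 <= 1 by rewrite !ge_min lexx orbT.
have e1Q : e1 * Q <= e / 4 by rewrite -ler_pdivlMr// !ge_min lexx orbT.
have e1e : e1 <= e / 4 by apply: le_trans e1Q; rewrite ler_peMr// ltW.
have [T1 T10 hT1] := clv _ e10; have [T2 T20 hT2] := clE _ e40.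
have [t] := clx e1 (Num.max T1 T2) e10; rewrite ge_max => /andP[T1t T2t] xt.
have t0 := le_trans T10 T1t; have vt := hT1 t T1t; have Et := hT2 t T2t.
exists (FB (x t)), (eta^-1 *: (x t - FB (x t)) - grad g (x t)).
have [fu sub] := FB_subgrad (x t).
move: vt Et; rewrite velocityE// /energy => vt Et.
have uxb : enorm (FB (x t) - xb) < e1 + e1.
  by apply: le_lt_trans (enorm_triangle (x t) _ _) _; exact: ltrD.
have e1v : e1 * (eta^-1 + beta) <= e / 4 by move: e1Q; rewrite /Q; lra.
split; first exact: FB_subgrad.
- by lra.
- rewrite opprK -addrA [- grad g (x t) + _]addrC.
  apply: le_lt_trans (enormD _ _) _; rewrite enormZ gtr0_norm// (enormB (x t)).
  rewrite (enormB (grad g xb)); have := g_lip (x t) xb.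
  have := ler_wpM2l beta_ge0 (ltW xt); have := ler_wpM2l (ltW ie0) (ltW vt); lra.
have gu := gd (FB (x t)) ltac:(by lra).
set q := (2 * eta)^-1 * enorm _ ^+ 2 in Et.
have q0 : 0 <= q by rewrite mulr_ge0 ?sqr_ge0// invr_ge0 mulr_ge0// ltW.
have qe : q <= e / 4.
  have V2 : enorm (FB (x t) - x t) ^+ 2 <= e1.
    rewrite expr2; apply: (@le_trans _ _ (e1 * 1)); last by rewrite mulr1.
    by apply: ler_pM; rewrite ?enorm_ge0// ltW// (lt_le_trans vt).
  have h : 0 <= 2^-1 * eta^-1 by rewrite mulr_ge0 ?ltW.
  have := ler_wpM2l h V2; rewrite -invfM -/q invfM.
  have := mulr_ge0 (ltW e10) (ltW ie0); have := mulr_ge0 (ltW e10) beta_ge0; lra.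
move: Et gu; rewrite !ltr_norml => /andP[? ?] /andP[? ?]; apply/andP; split; lra.
Qed.

(** For the subgradient supplied by [fbmap_subgrad] the terms in [eta^-1] cancel in the first block,
    leaving a difference of gradients of size at most [beta * enorm (FB z - z)]. *)
Lemma regH_slope z : exists2 w,
  limiting_subdiff (on_concat (regH f g eta)) (row_mx (FB z) z) w &
  enorm w <= (beta + eta^-1) * enorm (FB z - z).
Proof.
have ie0 : 0 < eta^-1 by rewrite invr_gt0.
exists (row_mx (grad g (FB z) - grad g z) (eta^-1 *: (z - FB z))).
  have := subgrad_regH f g beta eta g_diff beta_ge0 g_lip eta_gt0 _ z _ (FB_subgrad z).
  have -> : eta^-1 *: (FB z - z) = - (eta^-1 *: (z - FB z)).
    by rewrite -(opprB z) scalerN.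
  by rewrite subrDBK.
have V0 : 0 <= (beta + eta^-1) * enorm (FB z - z).
  by apply: mulr_ge0; [rewrite addr_ge0// ltW|exact: enorm_ge0].
rewrite -[_ <= _](@ler_pXn2r _ 2)// ?nnegrE ?enorm_ge0//.
rewrite enorm_row_mx enormZ (gtr0_norm ie0) (enormB z).
have h1 : enorm (grad g (FB z) - grad g z) ^+ 2 <= (beta * enorm (FB z - z)) ^+ 2.
  have b0 : 0 <= beta * enorm (FB z - z) by apply: mulr_ge0 => //; exact: enorm_ge0.
  by apply: (lerXn2r 2 _ b0 (g_lip _ _)); exact: enorm_ge0.
apply: le_trans (lerD h1 (lexx _)) _; rewrite mulrDl sqrrD addrAC lerDl.
by apply: mulrn_wge0; rewrite !mulr_ge0 ?enorm_ge0// ltW.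
Qed.

End Convergence.

Theorem theorem11 (R : realType) (n : nat)
    (f : 'rV[R]_n -> \bar R) (g : 'rV[R]_n -> R) (beta eta : R)
    (x0 : 'rV[R]_n) (x : R -> 'rV[R]_n)
    (f_proper : proper_fun f) (f_convex : econvex f)
    (f_lsc : lower_semicontinuous f)
    (g_diff : forall u, differentiable g u)
    (beta_ge0 : 0 <= beta)
    (g_lip : forall u v,
       enorm (grad g u - grad g v) <= beta * enorm (u - v))
    (fg_bounded_below : exists c : R, forall u, (c%:E <= fg_sum f g u)%E)
    (eta_gt0 : 0 < eta)
    (eta_beta : eta * beta * (3 + eta * beta) < 1)
    (x_sol : fb_solution f g eta x0 x)
    (x_bounded : exists M : R, forall t, 0 <= t -> enorm (x t) <= M)
    (H_KL : KL_function (on_concat (regH f g eta))) :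
  L1_on `[0, +oo[ (hl_deriv x) /\
  (exists2 xb : 'rV[R]_n, crit (fg_sum f g) xb & x t @[t --> +oo] --> xb).
Proof.
have vE := velocityE f g eta x0 x x_sol.
have eb0 : 0 <= eta * beta by apply: mulr_ge0 => //; exact: ltW.
pose En t := energy f g eta (x t).
pose A := beta * (1 + eta * beta); pose B := eta^-1.
have A0 : 0 <= A by apply: mulr_ge0 => //; exact: addr_ge0.
have B0 : 0 < B by rewrite invr_gt0.
have AB : A < B.
  by rewrite /A /B -[ltRHS]mul1r ltr_pdivlMr//; move: eta_beta eb0; nra.
have [K K0 step] := energy_step f g beta eta f_proper f_convex f_lsc g_diff
  beta_ge0 g_lip eta_gt0 fg_bounded_below eta_beta.
have [M M0 vM] := velocity_bounded f g beta eta x0 x f_proper f_convex f_lsc g_diff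
  beta_ge0 g_lip fg_bounded_below eta_gt0 eta_beta x_sol x_bounded.
have Lv0 : 0 <= 2 + eta * beta by exact: addr_ge0.
have xder := solution_increment f g eta x0 x x_sol.
have vlip := velocity_lipschitz f g beta eta x0 x f_proper f_convex f_lsc g_diff
  beta_ge0 g_lip fg_bounded_below eta_gt0 eta_beta x_sol.
have [c0 hc0] := energy_bounded_below f g beta eta f_proper f_convex f_lsc g_diff
  beta_ge0 g_lip fg_bounded_below eta_gt0 eta_beta.
have Enbd t : 0 <= t -> c0 <= En t by move=> _; exact: hc0.
have Enstep s t : 0 <= s -> 0 <= t -> En t - En s <=
    A * enorm (x t - x s) * enorm (hl_deriv x s)
    - B * dotv (hl_deriv x s) (x t - x s) + K * enorm (x t - x s) ^+ 2.
  by move=> s0 _; rewrite vE//; exact: step.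
have vv := velocity_vanishes x (hl_deriv x) En A B K M _ c0 A0 AB K0 M0 Lv0
  xder vlip vM Enstep Enbd.
have Ecv := energy_cvg x (hl_deriv x) En A B K M c0 A0 AB K0 M0 xder vM Enstep Enbd.
have Ele := energy_limit_le En c0 Enbd.
have Emono := energy_nonincreasing x (hl_deriv x) En A B K M A0 AB K0 M0 xder vM Enstep.
have Edini := energy_right_dini_le x (hl_deriv x) En A B K A0 AB K0 xder Enstep.
set El := energy_limit En in Ecv Ele.
have [xb clx] : exists xb, forall e T, 0 < e -> exists2 t, T <= t & enorm (x t - xb) < e.
  by case: x_bounded => Mx hMx; exact: (bounded_cluster x Mx hMx).
have [fxb sxb] : f xb = (El - g xb)%:E /\ convex_subgrad f xb (- grad g xb).
  apply: (cluster_point_subgrad f g beta eta x0 x f_proper f_convex f_lsc g_diff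
    beta_ge0 g_lip fg_bounded_below eta_gt0 eta_beta x_sol xb El clx vv) => e e0.
  have [T T0 hT] := Ecv e e0; exists T => // t Tt.
  rewrite ltr_norml; have := hT t Tt; have := Ele t (le_trans T0 Tt).
  by rewrite /En; move: (energy _ _ _ _) => E *; apply/andP; split; lra.
pose H := on_concat (regH f g eta).
(* This identity turns the gap in the KL inequality into [En s - El]. *)
have Hxb : H (row_mx xb xb) = El%:E.
  rewrite /H /on_concat /regH /fg_sum row_mxKl row_mxKr fxb subrr enorm0 expr0n mulr0 adde0.
  by rewrite -EFinD subrK.
have [|mu [U [phi [mu0 Uz phiT kl]]]] := H_KL (row_mx xb xb).
  by eexists; exact: (subgrad_regH f g beta eta g_diff beta_ge0 g_lip eta_gt0 xb xb _ sxb).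
have [r r0 rU] := (nbhs_enormP _ _).1 Uz.
(* With [x s] within [rho] of [xb] and speed below [rho], the pair [(u, x)] is at squared distance
   at most [5 * rho ^+ 2 < r ^+ 2] from [(xb, xb)]. *)
pose rho := r / 3; have rho0 : 0 < rho by rewrite divr_gt0.
have [m m0 mmu] : exists2 m, 0 < m & (m%:E <= mu)%E.
  move: mu0; case: (mu) => [m| |]//; last by move=> _; exists 1; rewrite ?leey.
  by rewrite lte_fin => m0; exists m.
have [T1 T10 hT1] := vv rho rho0; have [T2 T20 hT2] := Ecv m m0.
pose T := Num.max T1 T2.
have T0 : 0 <= T by rewrite le_max T10.
have vT s : T <= s -> enorm (hl_deriv x s) < rho.
  by rewrite ge_max => /andP[T1s _]; exact: hT1.
have Emu s : T <= s -> ((En s - El)%:E < mu)%E.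
  rewrite ge_max => /andP[_ T2s]; apply: lt_le_trans mmu.
  by rewrite lte_fin ltrBlDl; exact: hT2.
pose C := beta + eta^-1; have C0 : 0 < C by rewrite ltr_wpDl.
pose c := B - A; have c1 : 0 < c by rewrite subr_gt0.
pose Phi t := C / c * phi (En t - El).
have CC : 0 < C / c by rewrite divr_gt0.
have Elt s : T <= s -> 0 <= En s - El.
  by move=> Ts; rewrite subr_ge0; exact: Ele (le_trans T0 Ts).
have Phi_ge0 t : T <= t -> 0 <= Phi t.
  move=> Tt; apply: mulr_ge0; first exact: ltW.
  by case: phiT => + _ _ _ _; apply; split; [exact: Elt|exact: Emu].
have Phi_noninc s t : T <= s -> s <= t -> Phi t <= Phi s.
  move=> Ts st; rewrite ler_pM2l//; have Tt := le_trans Ts st.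
  apply: (Theta_nondecreasing mu phi phiT); [exact: Elt| |exact: Emu].
  by rewrite lerD2r; apply: Emono; rewrite (le_trans T0 Ts).
have Phi_dini s : T <= s -> enorm (x s - xb) < rho ->
    right_dini_le Phi s (- enorm (hl_deriv x s)).
  move=> Ts xs; have s0 := le_trans T0 Ts.
  apply: (desingularized_dini En phi mu El c C _ s phiT c1 C0 (enorm_ge0 _)
    (Edini s s0) _ (Emu s Ts)).
    by move=> t st; rewrite Ele ?(le_trans s0)//; apply: Emono; rewrite s0.
  move=> Els; have [w Hw wC] := regH_slope f g beta eta f_proper f_convex f_lsc g_diff
    beta_ge0 g_lip fg_bounded_below eta_gt0 eta_beta (x s).
  have Hs := regH_fbmap f g beta eta f_proper f_convex f_lsc g_diff
    beta_ge0 g_lip eta_gt0 fg_bounded_below eta_beta (x s).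
  have p0 : 0 < derive1 phi (En s - El).
    by case: phiT => _ _ _ _ [_ _]; apply; split; [rewrite subr_gt0|exact: Emu].
  have near : U (row_mx (fbmap f g eta (x s)) (x s)).
    apply: rU; rewrite opp_row_mx add_row_mx.
    rewrite -[_ < _](@ltr_pXn2r _ 2)// ?nnegrE ?enorm_ge0 ?(ltW r0)// enorm_row_mx.
    have vs := vT s Ts; rewrite vE// in vs.
    have : enorm (fbmap f g eta (x s) - xb) <= rho + rho.
      apply: le_trans (enorm_triangle (x s) _ _) _.
      by apply: lerD; exact: ltW.
    have := ltW xs; have := enorm_ge0 (fbmap f g eta (x s) - xb).
    have := enorm_ge0 (x s - xb); set a := enorm (x s - xb); set b := enorm (_ - xb); move=> a0 b0 ar br.
    have a2 : a ^+ 2 <= rho ^+ 2 by rewrite lerXn2r ?nnegrE// ltW.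
    have b2 : b ^+ 2 <= (rho + rho) ^+ 2.
      by rewrite lerXn2r ?nnegrE// addr_ge0// ltW.
    have : 0 < r ^+ 2 by rewrite exprn_gt0.
    by move: a2 b2; rewrite /rho; lra.
  have := kl _ near; rewrite -/H Hxb [H _]Hs -/(En s) lte_fin => /(_ Els).
  rewrite -lteBlDl// -EFinB => /(_ (Emu s Ts)) /= kls.
  rewrite -lee_fin EFinM; apply: le_trans kls _; apply: lee_wpmul2l.
    by rewrite lee_fin ltW.
  apply: (@le_trans _ _ (enorm (0 - w))%:E); first by apply: ereal_inf_lbound; exists w.
  by rewrite sub0r enormN lee_fin vE.
have Phi_small e : 0 < e -> exists t, [/\ T <= t, enorm (x t - xb) < e & Phi t < e].
  move=> e0; have [d d0 hd] := Theta_small mu phi mu0 phiT _ (divr_gt0 e0 CC).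
  have [T3 T30 hT3] := Ecv d d0.
  have [t + xt] := clx e (Num.max T T3) e0; rewrite ge_max => /andP[Tt T3t].
  exists t; split => //; rewrite /Phi mulrC -ltr_pdivlMr//.
  by apply: hd; [exact: Elt|rewrite ltrBlDl; exact: hT3|exact: Emu].
have xcvg := trajectory_cvg x (hl_deriv x) xder xb rho T Phi rho0 T0
  Phi_ge0 Phi_noninc Phi_dini Phi_small.
split; last first.
  exists xb.
    by have := subgrad_fg_sum f g beta g_diff beta_ge0 g_lip _ _ sxb; rewrite addNr.
  apply/cvg_enormP => e e0; have [T3 _ hT3] := xcvg e e0.
  by exists T3; split; [exact: num_real|move=> t /ltW; exact: hT3].
(* Freezing the velocity at negative times makes it Lipschitz on the whole line, as the
   measurability and integration lemmas require. *)
pose w t := hl_deriv x (Num.max 0 t).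
have wlip s t : enorm (w t - w s) <= (2 + eta * beta) * M * `|t - s|.
  have max0 (q : R) : 0 <= Num.max 0 q by rewrite le_max lexx.
  apply: le_trans (vlip _ _ (max0 s) (max0 t)) _; rewrite -mulrA; apply: ler_wpM2l => //.
  apply: (@le_trans _ _ (M * `|Num.max 0 t - Num.max 0 s|)); last first.
    by apply: ler_wpM2l => //; exact: normr_max0B.
  move: (Num.max 0 t) (Num.max 0 s) (max0 t) (max0 s) => {}t {}s t0 s0.
  wlog st : s t t0 s0 / s <= t.
    move=> W; have [|/ltW] := leP s t; first exact: W.
    by rewrite enormB distrC; exact: W.
  rewrite ger0_norm ?subr_ge0//.
  by apply: (trajectory_lipschitz x (hl_deriv x) M xder vM); rewrite s0.
have LM0 : 0 <= (2 + eta * beta) * M by exact: mulr_ge0.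
have wE t : 0 <= t -> w t = hl_deriv x t by move=> t0; rewrite /w max_r.
split=> [i|].
  apply: (@eq_measurable_fun _ _ _ _ _ (fun t => w t 0 i)).
    by move=> t; rewrite inE/= in_itv/= andbT => t0; rewrite wE.
  apply: measurable_funTS; apply: measurable_realfun.continuous_measurable_fun.
  apply: (lipschitz_continuous _ _ LM0) => s t; apply: le_trans (wlip s t).
  by apply: le_trans (coord_le_enorm _ i); rewrite !mxE.
pose y t := enorm (w t).
have yc : continuous y.
  apply: (lipschitz_continuous _ _ LM0) => s t; apply: le_trans (wlip s t).
  exact: enorm_dist.
have -> : (\int[lebesgue_measure]_(t in `[0%R, +oo[) (enorm (hl_deriv x t))%:E =
    \int[lebesgue_measure]_(t in `[0%R, +oo[) (y t)%:E)%E.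
  by apply: eq_integral => t; rewrite inE/= in_itv/= andbT => t0; rewrite /y wE.
have [T3 TT3 hT3] := xcvg rho rho0.
(* Past [T3] the trajectory stays near [xb]; [a >= 1] keeps to positive times, where
   [integral_derivable] applies. *)
pose a := Num.max T3 1.
have a1 : 1 <= a by rewrite le_max lexx orbT.
have T3a : T3 <= a by rewrite le_max lexx.
have a0 : 0 < a := lt_le_trans ltr01 a1.
pose Y (t : R) := (\int[lebesgue_measure]_(q in `[0, t]) y q)%R.
apply: (integral_lty_bounded y a (Y a + Phi a) yc _ (ltW a0)) => [t|b ab].
  exact: enorm_ge0.
rewrite -/(Y b) addrC -lerBlDr.
apply: (trajectory_length x (hl_deriv x) xb rho T Phi Phi_ge0 Phi_noninc Phi_dini) => //.
- exact: le_trans T3a.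
- by move=> t at_; apply: hT3; exact: le_trans at_.
- move=> s as_; apply: derivable_left_lsc.
  by have [] := integral_derivable y s yc (lt_trans a0 as_).
- move=> s as_; have s0 := lt_le_trans a0 as_.
  have [dY Ys] := integral_derivable y s yc s0.
  by have := derivable_right_dini_le Y s dY; rewrite Ys /y wE// ltW.
Qed.
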